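(* Let $K$ be a field, $S=K[x_1,\ldots,x_n]$, and let $\Delta$ be a locally complete intersection simplicial complex on $[n]=\{1,\ldots,n\}$. Then Stanley's conjecture holds for $S/I_\Delta$, i.e. $\operatorname{depth} S/I_\Delta\leq \operatorname{sdepth} S/I_\Delta$.
   Context: A simplicial complex $\Delta$ on $[n]$ is a collection of subsets of $[n]$ such that if $F\in\Delta$, then all subsets of $F$ are also in $\Delta$. The Stanley-Reisner ideal $I_\Delta$ is the square-free monomial ideal of $S$ generated by all monomials $x_{i_1}x_{i_2}\cdots x_{i_t}$ such that $\{i_1,i_2,\ldots,i_t\}\notin\Delta$ (with $i_1,\ldots,i_t$ distinct). A simplicial complex $\Delta$ on $[n]$ is said to be locally complete intersection if $\{\{1\},\{2\},\ldots,\{n\}\}\subseteq\Delta$ and $(I_\Delta)_{\mathfrak p}$ is a complete intersection ideal of $S_{\mathfrak p}$ (i.e. generated by a regular sequence) for all $\mathfrak p\in\operatorname{Proj} S/I_\Delta$, where points of $\operatorname{Proj} S/I_\Delta$ are regarded as homogeneous prime ideals of $S$ containing $I_\Delta$ and not containing $(x_1,\ldots,x_n)$. For a monomial ideal $I$ of $S$, a Stanley decomposition of $S/I$ is a decomposition $\mathcal D: S/I=\bigoplus_{i=1}^r u_iK[Z_i]$ as a direct sum of $K$-vector spaces, where each $u_i$ is a monomial in $S$ and $Z_i\subseteq\{x_1,\ldots,x_n\}$; here $u_iK[Z_i]$ is identified with the $K$-subspace of $S/I$ spanned by the residue classes of the monomials $u_iv$, $v$ a monomial in $K[Z_i]$,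 none of which lies in $I$. Put $\operatorname{sdepth}\mathcal D:=\min\{|Z_i|: i=1,\ldots,r\}$ and $\operatorname{sdepth} S/I:=\max\{\operatorname{sdepth}\mathcal D:\mathcal D \text{ is a Stanley decomposition of } S/I\}$. Depth is taken with respect to the ideal $(x_1,\ldots,x_n)$. *)

(* Defs.v *)
From HB Require Import structures.
From mathcomp Require Import all_boot all_order all_algebra.
From mathcomp Require Import generic_quotient ring_quotient fraction.
From mathcomp Require Import boolp classical_sets.
From mathcomp Require Import mpoly.

Set Implicit Arguments.
Unset Strict Implicit.
Unset Printing Implicit Defensive.

Import Order.TTheory GRing.Theory.
Local Open Scope classical_set_scope.
Local Open Scope ring_scope.

Local Notation "x %:F" := (FracField.tofrac x).

(* Suprema of sets of naturals in {0, 1, ..., oo}: [None] is oo and the        *)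
(* supremum of the empty set is 0.                                            *)
Definition enat := option nat.

Definition enat_le (a b : enat) : Prop :=
  match a, b with
  | _, None => True
  | None, Some _ => False
  | Some x, Some y => (x <= y)%N
  end.

Definition enat_sup (A : set nat) : enat :=
  if `[< has_ubound A >] then Some (supremum 0%N A) else None.

Section Ideals.
Variable R : comNzRingType.

Definition ideal_gen (G : set R) : set R :=
  [set f | exists2 s : seq (R * R),
     (forall c, c \in s -> G c.2) & f = \sum_(c <- s) c.1 * c.2].

Definition ideal_adj (J : set R) (ys : seq R) : set R :=
  ideal_gen (J `|` [set` ys]).

(* [ys] is a regular sequence on the R-module R / J, for J an ideal of R. *)
Definition regular_seq (J : set R) (ys : seq R) : Prop :=
  (forall i a, (i < size ys)%N ->
     ideal_adj J (take i ys) (nth 0 ys i * a) -> ideal_adj J (take i ys) a)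
  /\ ~ ideal_adj J ys 1.

(* depth of the R-module R / J with respect to the ideal m *)
Definition depth (m J : set R) : enat :=
  enat_sup [set d | exists ys : seq R,
    [/\ size ys = d, forall y, y \in ys -> m y & regular_seq J ys]].

Definition complete_intersection (J : set R) : Prop :=
  exists2 ys : seq R, regular_seq [set 0] ys & J = ideal_gen [set` ys].

End Ideals.

(* The localization R_p of a domain R at a prime ideal p, as the subring of    *)
(* the fractions a / s, with s outside p, of the fraction field of R.         *)
Section Localization.
Variables (R : idomainType) (p : prime_idealr R).

Definition loc_pred : {pred {fraction R}} :=
  fun x => `[< exists a s : R, s \notin p /\ x = a%:F / s%:F >].

Lemma loc_den_neq0 (s : R) : s \notin p -> s%:F != 0.
Proof. by apply: contraNneq => /eqP; rewrite tofrac_eq0 => /eqP ->; apply: idealr0. Qed.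

Lemma loc_subring_closed : subring_closed loc_pred.
Proof.
have p1 : 1 \notin p by rewrite idealr1.
have pM (s t : R) : s \notin p -> t \notin p -> s * t \notin p.
  by move=> ps pt; rewrite prime_idealrM negb_or ps pt.
split.
- by apply/asboolP; exists 1, 1; rewrite p1 tofrac1 divr1.
- move=> _ _ /asboolP[a [s [ps ->]]] /asboolP[b [t [pt ->]]]; apply/asboolP.
  exists (a * t - b * s), (s * t); split; first exact: pM.
  rewrite tofracB !tofracM -mulNr addf_div ?loc_den_neq0 //.
  by rewrite mulNr.
- move=> _ _ /asboolP[a [s [ps ->]]] /asboolP[b [t [pt ->]]]; apply/asboolP.
  exists (a * b), (s * t); split; first exact: pM.
  by rewrite !tofracM mulf_div.
Qed.

HB.instance Definition _ :=
  GRing.isSubringClosed.Build {fraction R} loc_pred loc_subring_closed.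

Record loc := Loc { loc_val : {fraction R}; loc_valP : loc_val \in loc_pred }.

HB.instance Definition _ := [isSub for loc_val].
HB.instance Definition _ := [Choice of loc by <:].
HB.instance Definition _ := [SubChoice_isSubComNzRing of loc by <:].

(* the extension J_p of an ideal J of R to R_p *)
Definition loc_ideal (J : set R) : set loc :=
  [set x | exists a s : R, [/\ J a, s \notin p & loc_val x = a%:F / s%:F]].

End Localization.

Arguments loc_ideal [R] p J.

Section SimplicialComplexes.
Variable n : nat.

(* The empty collection of faces is allowed. *)
Definition simplicial_complex (Delta : {set {set 'I_n}}) : Prop :=
  forall F G : {set 'I_n}, F \in Delta -> G \subset F -> G \in Delta.

Variable K : fieldType.

Definition sr_ideal (Delta : {set {set 'I_n}}) : set {mpoly K[n]} :=
  ideal_gen [set f | exists2 F : {set 'I_n},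
    F \notin Delta & f = \prod_(i in F) 'X_i].

Definition max_homog_ideal : set {mpoly K[n]} :=
  ideal_gen [set f | exists i : 'I_n, f = 'X_i].

Definition homog_ideal (J : set {mpoly K[n]}) : Prop :=
  J = ideal_gen [set f | J f /\ f \is homog mdeg].

Definition in_Proj (J : set {mpoly K[n]}) (p : prime_idealr {mpoly K[n]}) :
    Prop :=
  [/\ homog_ideal [set f | f \in p],
      J `<=` [set f | f \in p]
    & ~ (max_homog_ideal `<=` [set f | f \in p])].

Definition locally_complete_intersection (Delta : {set {set 'I_n}}) : Prop :=
  (forall i : 'I_n, [set i]%SET \in Delta) /\
  (forall p : prime_idealr {mpoly K[n]}, in_Proj (sr_ideal Delta) p ->
     complete_intersection (loc_ideal p (sr_ideal Delta))).

(* K[Z], as a subring of S = {mpoly K[n]} *)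
Definition poly_in (Z : {set 'I_n}) : set {mpoly K[n]} :=
  [set g | forall (m : 'X_{1..n}) (i : 'I_n),
     m \in msupp g -> m i != 0%N -> i \in Z].

Definition stanley_space (u : 'X_{1..n}) (Z : {set 'I_n}) : set {mpoly K[n]} :=
  [set f | exists2 g, poly_in Z g & f = 'X_[u] * g].

(* The images in S / J of the subspaces V i of S span S / J, and their sum is  *)
(* direct; elements of S / J are given by representatives in S.               *)
Definition direct_sum_mod (J : set {mpoly K[n]}) (r : nat)
    (V : 'I_r -> set {mpoly K[n]}) : Prop :=
  (forall f, exists2 w : 'I_r -> {mpoly K[n]},
     (forall i, V i (w i)) & J (f - \sum_i w i)) /\
  (forall w : 'I_r -> {mpoly K[n]},
     (forall i, V i (w i)) -> J (\sum_i w i) -> forall i, J (w i)).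

Definition stanley_decomposition (J : set {mpoly K[n]}) (r : nat)
    (u : 'I_r -> 'X_{1..n}) (Z : 'I_r -> {set 'I_n}) : Prop :=
  (forall (i : 'I_r) (v : 'X_{1..n}),
     poly_in (Z i) 'X_[v] -> ~ J ('X_[u i] * 'X_[v])) /\
  direct_sum_mod J (fun i => stanley_space (u i) (Z i)).

(* As #|Z i| <= n, the neutral element n only matters when r = 0, and then     *)
(* S / J = 0.                                                                 *)
Definition sdepth_decomposition (r : nat) (Z : 'I_r -> {set 'I_n}) : nat :=
  \big[minn/n]_(i < r) #|Z i|.

Definition sdepth (J : set {mpoly K[n]}) : enat :=
  enat_sup [set d | exists (r : nat) (u : 'I_r -> 'X_{1..n})
                      (Z : 'I_r -> {set 'I_n}),
    stanley_decomposition J u Z /\ d = sdepth_decomposition Z].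

End SimplicialComplexes.

Arguments sr_ideal [n] K Delta.
Arguments max_homog_ideal n K : clear implicits.
Arguments locally_complete_intersection [n] K Delta.

(* Main.v *)
(* A squarefree monomial ideal is a complete intersection iff the supports of  *)

(* The algebra enters through one determinant. If a family z generates a complete intersection J,
   some matrix M with z = M z has the property that det M times any coefficient of a syzygy of z
   lies in J ([complete_intersection_relations]). At the prime of a vertex v the link circuits of v
   give such a family z, and M becomes the identity modulo the prime, so det M is a unit. The syzygy
   between two circuits C and D, with coefficients x_{D \ C} and -x_{C \ D}, then puts x_{D \ C}
   into J, which is impossible if C and D are distinct and meet. This is
   [lci_link_circuits_disjoint].

   The rest is combinatorial. [connected_triangle_free] and [circuits_disjointP] turn disjointness
   in the links into the alternatives above. In each of them a single number separates the
   invariants: [depth_disconnected] or [depth_le_dim] bounds the depth by it from above, and an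
   explicit partition of the faces into intervals, converted by [sdepth_interval_partition], bounds
   the Stanley depth from below. *)
(* its minimal generators, the circuits of the complex, are pairwise disjoint. *)
(* Localizing at the prime generated by all variables but x_v, and using that  *)
(* the conormal module of a complete intersection is free, one finds that the  *)
(* circuits of every vertex link are pairwise disjoint. Then (Terai-Yoshida)   *)
(* one of the following holds.                                                 *)
(* - The 1-skeleton is disconnected; then depth <= 1 <= sdepth.                *)
(* - It is connected and some vertex lies in no triangle; then neither does    *)
(*   any neighbour, so the dimension is at most 1 and depth <= 2; a spanning   *)
(*   tree yields a partition into intervals showing 2 <= sdepth.               *)
(* - It is connected and all vertices lie in triangles; then its diameter is   *)
(*   at most 2, its complement is a matching, and the circuits of the complex  *)
(*   itself are pairwise disjoint. If there are r of them, the faces have at   *)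
(*   most n - r elements, so depth <= n - r, and sorting the faces by their    *)
(*   first missing element in each circuit shows n - r <= sdepth.              *)
(* The bound of the depth by the size of the largest face comes from counting: *)
(* the monomials in a regular sequence are linearly independent modulo I, and  *)
(* those of bounded exponent evaluate to polynomials of bounded degree.        *)
Require Import Defs.
From HB Require Import structures.
From mathcomp Require Import all_boot all_order all_algebra.
From mathcomp Require Import ring_quotient fraction.
From mathcomp Require Import boolp classical_sets.
From mathcomp Require Import mpoly fintype finset ring.

Set Implicit Arguments.
Unset Strict Implicit.
Unset Printing Implicit Defensive.

Import Order.TTheory GRing.Theory.
Local Open Scope ring_scope.

(** * Ideals and regular sequences *)

Section IdealGen.
Variable R : comNzRingType.
Implicit Types (G J : set R) (a f g : R) (ys : seq R).

Definition ideal_set J : Prop :=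
  [/\ J 0, forall f g, J f -> J g -> J (f + g) & forall a f, J f -> J (a * f)].

Lemma ideal_gen_ideal G : ideal_set (ideal_gen G).
Proof.
split.
- by exists [::]; rewrite ?big_nil // => c.
- move=> _ _ [s sG ->] [t tG ->]; exists (s ++ t); last by rewrite big_cat.
  by move=> c; rewrite mem_cat => /orP[/sG|/tG].
- move=> a _ [s sG ->]; exists [seq (a * c.1, c.2) | c <- s].
    by move=> c /mapP[d /sG Gd ->].
  by rewrite big_map mulr_sumr; apply: eq_bigr => c _; rewrite mulrA.
Qed.

Lemma ideal_gen_sub G f : G f -> ideal_gen G f.
Proof.
move=> Gf; exists [:: (1, f)]; last by rewrite big_seq1 mul1r.
by move=> c; rewrite inE => /eqP ->.
Qed.

Lemma ideal_sum J (T : Type) (r : seq T) (P : pred T) (F : T -> R) :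
  ideal_set J -> (forall i, P i -> J (F i)) -> J (\sum_(i <- r | P i) F i).
Proof. by case=> J0 JD _ JF; apply: big_ind. Qed.

Lemma ideal_opp J f : ideal_set J -> J f -> J (- f).
Proof. by case=> _ _ JM /(JM (-1)); rewrite mulN1r. Qed.

Lemma ideal_sub J f g : ideal_set J -> J f -> J g -> J (f - g).
Proof. by move=> iJ Jf Jg; case: (iJ) => _ JD _; exact: JD Jf (ideal_opp iJ Jg). Qed.

Lemma ideal_mulr J f a : ideal_set J -> J f -> J (f * a).
Proof. by case=> _ _ JM Jf; rewrite mulrC; apply: JM. Qed.

Lemma ideal_gen_min G J : ideal_set J -> (forall f, G f -> J f) ->
  forall f, ideal_gen G f -> J f.
Proof.
move=> iJ GJ _ [s sG ->]; rewrite big_seq.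
apply: ideal_sum => // => c /sG /GJ; case: iJ => _ _; apply.
Qed.

Lemma ideal_adj_nil J f : ideal_set J -> ideal_adj J [::] f -> J f.
Proof. by move=> iJ; apply: ideal_gen_min => // g []. Qed.

Lemma ideal_adj_sub J ys f : J f -> ideal_adj J ys f.
Proof. by move=> Jf; apply: ideal_gen_sub; left. Qed.

Lemma ideal_adj_cons J y ys :
  ideal_adj J (y :: ys) = ideal_adj (ideal_adj J [:: y]) ys.
Proof.
apply/seteqP; split; apply: ideal_gen_min; try exact: ideal_gen_ideal.
  move=> f [Jf|]; first by do 2!apply: ideal_adj_sub.
  rewrite /= inE => /orP[/eqP ->|fys]; last by apply: ideal_gen_sub; right.
  by apply/ideal_adj_sub/ideal_gen_sub; right; rewrite /= inE.
move=> f [|fys]; last first.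
  by apply: ideal_gen_sub; right; rewrite /= inE fys orbT.
apply: ideal_gen_min; first exact: ideal_gen_ideal.
move=> g [Jg|]; first exact: ideal_adj_sub.
rewrite /= inE => /eqP ->.
by apply: ideal_gen_sub; right; rewrite /= inE eqxx.
Qed.

Lemma ideal_adjP J ys f : ideal_set J -> ideal_adj J ys f ->
  exists d : nat -> R, J (f - \sum_(i < size ys) d i * ys`_i).
Proof.
move=> iJ; case: (iJ) => J0 JD JM.
pose J' := [set f | exists d : nat -> R,
  J (f - \sum_(i < size ys) d i * ys`_i)]%classic.
apply: (@ideal_gen_min _ J'); first split.
- exists (fun=> 0); rewrite big1 ?subr0 // => i _; exact: mul0r.
- move=> g h [a Ja] [b Jb]; exists (fun i => a i + b i).
  under eq_bigr do rewrite mulrDl.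
  by rewrite big_split opprD addrACA; apply: JD.
- move=> a g [b Jb]; exists (fun i => a * b i).
  under eq_bigr do rewrite -mulrA.
  by rewrite -mulr_sumr -mulrBr; apply: JM.
move=> g [Jg|].
  by exists (fun=> 0); rewrite big1 ?subr0 // => i _; exact: mul0r.
(* Using the first index of g leaves one nonzero coefficient even if [ys] has repetitions. *)
rewrite /= => gys; exists (fun i => (i == index g ys)%:R).
have ltg : (index g ys < size ys)%N by rewrite index_mem.
rewrite (bigD1 (Ordinal ltg)) //= eqxx mul1r nth_index // big1 ?addr0 ?subrr //.
by move=> i /negbTE; rewrite -val_eqE /= => ->; rewrite mul0r.
Qed.

Lemma regular_seq_cons J y ys : ideal_set J -> regular_seq J (y :: ys) ->
  (forall a, J (y * a) -> J a) /\ regular_seq (ideal_adj J [:: y]) ys.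
Proof.
move=> iJ [reg nt]; split=> [a Ja|].
  by apply: ideal_adj_nil => //; apply: (reg 0%N) => //; apply: ideal_adj_sub.
split; last by rewrite -ideal_adj_cons.
move=> i a i_lt; rewrite -!ideal_adj_cons; exact: (reg i.+1).
Qed.

Lemma ideal_adj_take J ys k f : ideal_adj J (take k ys) f -> ideal_adj J ys f.
Proof.
apply: ideal_gen_min; first exact: ideal_gen_ideal.
move=> g [Jg|gys]; apply: ideal_gen_sub; [by left | right].
exact: mem_take gys.
Qed.

(* In other words, the conormal module (y) / (y)^2 of the ideal generated by  *)
(* a regular sequence y is free on y.                                         *)
Lemma regular_seq_syzygy J ys (c : nat -> R) : ideal_set J ->
  regular_seq J ys -> J (\sum_(i < size ys) c i * ys`_i) ->
  forall i, (i < size ys)%N -> ideal_adj J ys (c i).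
Proof.
move=> iJ [reg _].
suff main k : (k <= size ys)%N -> forall c : nat -> R,
    J (\sum_(i < k) c i * ys`_i) ->
    forall i, (i < k)%N -> ideal_adj J ys (c i).
  exact: (main (size ys)).
elim: k => [//|k IH] ltk {}c; rewrite big_ord_recr /= => Jsum.
have size_take_k : size (take k ys) = k by rewrite size_takel // ltnW.
have iadj zs : ideal_set (ideal_adj J zs) by exact: ideal_gen_ideal.
have [_ adjD adjM] := iadj ys.
(* By the relation, y_k c_k lies in the ideal of J and the earlier elements; regularity cancels
   y_k. *)
have ck : ideal_adj J (take k ys) (c k).
  apply: (reg k) => //; rewrite mulrC -[X in ideal_adj _ _ X]
    (addKr (\sum_(i < k) c i * ys`_i)).
  case: (iadj (take k ys)) => _ tD tM; apply: tD; last exact: ideal_adj_sub.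
  apply: ideal_opp => //; apply: ideal_sum => // i _; apply: tM.
  apply: ideal_gen_sub; right => /=.
  by rewrite -(@nth_take k) //; apply: mem_nth; rewrite size_take_k.
have [d Jd] := ideal_adjP iJ ck.
(* Writing c_k through the earlier elements yields a shorter relation, whose coefficients differ
   from the c_i by multiples of y_k. *)
have Jsum' : J (\sum_(i < k) (c i + ys`_k * d i) * ys`_i).
  case: (iJ) => _ JD JM.
  have := JD _ _ Jsum (ideal_opp iJ (JM ys`_k _ Jd)).
  rewrite size_take_k mulrBr opprB addrACA (mulrC (c k)) subrr addr0.
  rewrite mulr_sumr -big_split; congr J; apply: eq_bigr => i _ /=.
  by rewrite nth_take // mulrDl mulrA.
move=> i; rewrite ltnS leq_eqVlt => /orP[/eqP ->|ltik].
  exact: ideal_adj_take ck.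
rewrite -[c i](addrK (ys`_k * d i)); apply: adjD.
  by apply: (IH (ltnW ltk) (fun i => c i + ys`_k * d i)).
apply/(ideal_opp (iadj ys))/(ideal_mulr _ (iadj ys)).
by apply: ideal_gen_sub; right; apply: mem_nth.
Qed.

End IdealGen.

(** * Stanley-Reisner ideals *)

Section MonomialSupport.
Variable n : nat.
Implicit Types (m : 'X_{1..n}) (F W : {set 'I_n}).

Definition mnm_supp m : {set 'I_n} := [set i | m i != 0%N].

Definition mnm_ind F : 'X_{1..n} := [multinom (i \in F : nat) | i < n].

Lemma in_mnm_supp m i : (i \in mnm_supp m) = (m i != 0%N).
Proof. by rewrite inE. Qed.

Lemma mnm_indE F i : mnm_ind F i = (i \in F).
Proof. exact: mnmE. Qed.

Lemma mnm_suppD m1 m2 : mnm_supp (m1 + m2) = mnm_supp m1 :|: mnm_supp m2.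
Proof. by apply/setP=> i; rewrite !inE mnmDE addn_eq0 negb_and. Qed.

Lemma mnm_supp_ind F : mnm_supp (mnm_ind F) = F.
Proof. by apply/setP=> i; rewrite !inE mnm_indE; case: (i \in F). Qed.

Lemma mnm_supp0 : mnm_supp 0 = set0.
Proof. by apply/setP=> i; rewrite !inE mnm0E. Qed.

Lemma mnm_supp_eq0 m : (mnm_supp m == set0) = (m == 0%MM).
Proof.
apply/eqP/eqP=> [m0|->]; last exact: mnm_supp0.
apply/mnmP=> i; rewrite mnm0E; apply/eqP; rewrite -[_ == _]negbK -in_mnm_supp.
by rewrite m0 inE.
Qed.

Lemma mnm_ind_le F m : (mnm_ind F <= m)%MM = (F \subset mnm_supp m).
Proof.
apply/mnm_lepP/subsetP=> [le i iF|sub i]; first last.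
  by rewrite mnm_indE; case: (boolP (i \in F)) => // /sub; rewrite inE lt0n.
by have := le i; rewrite mnm_indE iF inE lt0n.
Qed.

Lemma prodX_ind (R : nzRingType) F :
  \prod_(i in F) 'X_i = 'X_[mnm_ind F] :> {mpoly R[n]}.
Proof.
rewrite [RHS]mpolyXE_id big_mkcond /=; apply: eq_bigr => i _.
by rewrite mnm_indE; case: (i \in F).
Qed.

End MonomialSupport.

Lemma mcoeffM_neq0 (n : nat) (R : nzRingType) (p q : {mpoly R[n]}) m :
  (p * q)@_m != 0 ->
  exists m1 m2, [/\ m = (m1 + m2)%MM, p@_m1 != 0 & q@_m2 != 0].
Proof.
rewrite -mcoeff_msupp => /msuppM_le /allpairsP[[m1 m2] /= [m1p m2q ->]].
by exists m1, m2; rewrite -!mcoeff_msupp.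
Qed.

Section StanleyReisnerIdeal.
Variables (n : nat) (K : fieldType) (Delta : {set {set 'I_n}}).
Hypothesis DeltaP : simplicial_complex Delta.
Implicit Types (m : 'X_{1..n}) (f g : {mpoly K[n]}) (F W : {set 'I_n}).
Local Notation I := (sr_ideal K Delta).

Lemma sr_ideal_ideal : ideal_set I.
Proof. exact: ideal_gen_ideal. Qed.

(** Nonfaces are closed under supersets, so the right side is an ideal; conversely each monomial is
    divisible by the squarefree monomial of its support. Membership thus becomes a condition on
    coefficients. *)
Lemma sr_idealP f :
  I f <-> forall m, f@_m != 0 -> mnm_supp m \notin Delta.
Proof.
split.
  pose J := [set f : {mpoly K[n]} |
    forall m, f@_m != 0 -> mnm_supp m \notin Delta]%classic.
  move: f; apply: (@ideal_gen_min _ _ J); first split.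
  - by move=> m; rewrite mcoeff0 eqxx.
  - move=> f g Jf Jg m; rewrite mcoeffD.
    by have [/eqP f0|/Jf //] := boolP (f@_m == 0); rewrite f0 add0r => /Jg.
  - move=> a f Jf _ /mcoeffM_neq0[m1 [m2 [-> _ /Jf]]].
    by apply: contra => /DeltaP; apply; rewrite mnm_suppD subsetUr.
  move=> _ [F FD ->] m; rewrite prodX_ind mcoeffX.
  by case: (_ =P m) => [<- _|_]; rewrite ?mnm_supp_ind ?eqxx.
move=> nf; rewrite [f]mpolyE big_seq; apply: ideal_sum => [|m].
  exact: sr_ideal_ideal.
rewrite mcoeff_msupp => /nf mD.
have le_m : (mnm_ind (mnm_supp m) <= m)%MM by rewrite mnm_ind_le.
rewrite -(submK le_m) mpolyXD scalerAl -prodX_ind.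
case: sr_ideal_ideal => _ _; apply; apply: ideal_gen_sub.
by exists (mnm_supp m).
Qed.

Lemma sr_idealX m : I 'X_[m] <-> mnm_supp m \notin Delta.
Proof.
rewrite sr_idealP; split=> [|mD k]; first by apply; rewrite mcoeffX eqxx oner_neq0.
by rewrite mcoeffX; case: (_ =P k) => [<-|_]; rewrite ?eqxx.
Qed.

Lemma sr_ideal_coef0 f m : I f -> mnm_supp m \in Delta -> f@_m = 0.
Proof. by move=> /sr_idealP nf mD; apply: contraTeq mD => /nf. Qed.

(** Induction on the degree of m: apart from q_0 f_m, the coefficient of q f at m involves f only at
    proper divisors of m, whose supports are again faces. *)
Lemma sr_ideal_coprime f q : q@_0 != 0 -> I (q * f) -> I f.
Proof.
move=> q0 Iqf; apply/sr_idealP => m; apply: contraNN => mD.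
have [d] := ubnP (mdeg m); elim: d => // d IH in m mD *; rewrite ltnS => md.
have := sr_ideal_coef0 Iqf mD; rewrite -[q](subrK (q@_0)%:MP) mulrDl mcoeffD.
rewrite mcoeffCM [X in X + _](_ : _ = 0).
  by rewrite add0r => /eqP; rewrite mulf_eq0 (negbTE q0).
apply/eqP/negPn/negP => /mcoeffM_neq0[m1 [m2 [mE q1 /negP[]]]].
have m1N0 : m1 != 0%MM.
  by apply: contraNneq q1 => ->; rewrite mcoeffB mcoeffC eqxx mulr1 subrr.
apply: IH; first by apply: DeltaP mD _; rewrite mE mnm_suppD subsetUr.
apply: leq_trans md; rewrite mE mdegD -[X in (X < _)%N]add0n ltn_add2r.
by rewrite lt0n mdeg_eq0.
Qed.

Lemma mcoeff_max_homog_ideal f : max_homog_ideal n K f -> f@_0 = 0.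
Proof.
pose J := [set f : {mpoly K[n]} | f@_0 = 0]%classic.
apply: (@ideal_gen_min _ _ J); first split.
- exact: mcoeff0.
- by move=> g h g0 h0; rewrite /J /= mcoeffD g0 h0 addr0.
- by move=> a g g0; rewrite /J /= rmorphM /= g0 mulr0.
by move=> _ [i ->]; rewrite /J /= mcoeffX mnm1_eq0.
Qed.

End StanleyReisnerIdeal.

(** * Setting the variables outside a set to zero *)

Section Restriction.
Variables (n : nat) (K : fieldType) (W : {set 'I_n}).
Implicit Types (m : 'X_{1..n}) (f g : {mpoly K[n]}).

Definition mrestr : {mpoly K[n]} -> {mpoly K[n]} :=
  mmap (@mpolyC n K) (fun i => if i \in W then 'X_i else 0).

HB.instance Definition _ := GRing.RMorphism.on mrestr.

Lemma mrestrX m :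
  mrestr 'X_[m] = if mnm_supp m \subset W then 'X_[m] else 0.
Proof.
rewrite /mrestr mmapX /mmap1; have [sW|/subsetPn[i]] := boolP (_ \subset _).
  rewrite [RHS]mpolyXE_id; apply: eq_bigr => i _.
  have [//|iW] := boolP (i \in W).
  have: i \notin mnm_supp m by apply: contra iW => /(subsetP sW).
  by rewrite in_mnm_supp negbK => /eqP ->.
rewrite in_mnm_supp => im iW; apply/eqP/prodf_eq0; exists i => //.
by rewrite (negbTE iW) expr0n (negbTE im).
Qed.

Lemma mcoeff_mrestr f m :
  (mrestr f)@_m = if mnm_supp m \subset W then f@_m else 0.
Proof.
elim/mpolyind: f => [|c k p _ _ IH]; first by rewrite raddf0 mcoeff0 if_same.
rewrite raddfD !mcoeffD /= IH {1}/mrestr mmapZ mul_mpolyC -/(mrestr _).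
rewrite mrestrX !mcoeffZ; case: ifP => kW; rewrite mcoeffX ?mcoeff0 ?mulr0.
  by case: (k =P m) => [<-|_]; rewrite ?kW // mulr0 !add0r.
by case: (k =P m) => [<-|_]; rewrite ?kW ?mulr0 !add0r.
Qed.

End Restriction.

(** * Depth of disconnected complexes *)

Section ENat.
Local Open Scope nat_scope.

Lemma enat_sup_le (A : set nat) d :
  (forall x, A x -> x <= d) -> enat_le (enat_sup A) (Some d).
Proof.
move=> ubA; rewrite /enat_sup; case: asboolP => [_|[]]; last by exists d.
rewrite /enat_le /supremum; case: ifP => // _; case: xgetP => // x _ [_].
exact.
Qed.

Lemma enat_sup_ge (A : set nat) d : A d -> enat_le (Some d) (enat_sup A).
Proof.
move=> Ad; rewrite /enat_sup; case: asboolP => // ubA.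
exact: (ge_supremum_Nmem 0 (nat_supremums_neq0 ubA) Ad).
Qed.

Lemma enat_le_trans a b c : enat_le a b -> enat_le b c -> enat_le a c.
Proof. by case: a b c => [a|] [b|] [c|] //=; exact: leq_trans. Qed.

End ENat.

Section Disconnected.
Variables (n : nat) (K : fieldType) (Delta : {set {set 'I_n}}).
Hypothesis DeltaP : simplicial_complex Delta.
Hypothesis vertD : forall i : 'I_n, [set i]%SET \in Delta.
Local Notation I := (sr_ideal K Delta).
Implicit Types (f g c : {mpoly K[n]}).

Section Splitting.
Variable W : {set 'I_n}.
Hypothesis splitW :
  forall F, F \in Delta -> (F \subset W) || (F \subset ~: W).

(** A nonempty face lies on exactly one side; only the constant term would be counted twice. *)
Lemma sr_ideal_split f : f@_0 = 0 -> I (f - (mrestr W f + mrestr (~: W) f)).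
Proof.
move=> f0; apply/(sr_idealP DeltaP) => m; apply: contraNN => mD.
have [->|m0] := eqVneq m 0%MM; first
  by rewrite mcoeffB mcoeffD !mcoeff_mrestr f0 !if_same addr0 subrr.
have [i im] : exists i, i \in mnm_supp m by apply/set0Pn; rewrite mnm_supp_eq0.
have disj : ~~ ((mnm_supp m \subset W) && (mnm_supp m \subset ~: W)).
  apply/negP=> /andP[/fintype.subsetP/(_ i im) iW /fintype.subsetP/(_ i im)].
  by rewrite inE iW.
rewrite mcoeffB mcoeffD !mcoeff_mrestr.
by case/orP: (splitW mD) disj => -> /=;
  [move=> /negbTE -> | rewrite andbT => /negbTE ->]; rewrite ?addr0 ?add0r subrr.
Qed.

(** Each monomial of the product has a support meeting both sides, hence a nonface. *)
Lemma sr_ideal_mrestrM f g : f@_0 = 0 -> g@_0 = 0 ->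
  I (mrestr W f * mrestr (~: W) g).
Proof.
move=> f0 g0; apply/(sr_idealP DeltaP) => _ /mcoeffM_neq0[m1 [m2 [-> ]]].
rewrite !mcoeff_mrestr; case: ifP; rewrite ?eqxx // => m1W f1.
case: ifP; rewrite ?eqxx // => m2W g2.
have [i im] : exists i, i \in mnm_supp m1.
  by apply/set0Pn; rewrite mnm_supp_eq0; apply: contraNneq f1 => ->; rewrite f0.
have [j jm] : exists i, i \in mnm_supp m2.
  by apply/set0Pn; rewrite mnm_supp_eq0; apply: contraNneq g2 => ->; rewrite g0.
apply/negP => /splitW; rewrite mnm_suppD !subUset m1W m2W andbT.
case/orP=> /fintype.subsetP.
  by move/(_ j jm) => jW; move/fintype.subsetP/(_ j jm): m2W; rewrite inE jW.
by move/(_ i im); move/fintype.subsetP/(_ i im): m1W; rewrite inE => ->.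
Qed.

Lemma sr_ideal_mrestr (V : {set 'I_n}) f : I f -> I (mrestr V f).
Proof.
move=> /(sr_idealP DeltaP) nf; apply/(sr_idealP DeltaP) => m.
by rewrite mcoeff_mrestr; case: ifP; rewrite ?eqxx // => _ /nf.
Qed.

(** The part of f outside W annihilates x_j modulo I. If the part inside W were in I, then f would
    annihilate x_j, although {j} is a face. *)
Lemma regular_mrestr_notin f j : j \in W -> f@_0 = 0 ->
  (forall a, I (f * a) -> I a) -> ~ I (mrestr W f).
Proof.
move=> jW f0 freg If.
have iI := sr_ideal_ideal K Delta; have [_ ID IM] := iI.
have: I ('X_j : {mpoly K[n]}).
  apply: freg; rewrite -[f](subrK (mrestr W f + mrestr (~: W) f)) mulrDl.
  apply: (ID); first by apply: ideal_mulr => //; apply: sr_ideal_split.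
  rewrite mulrDl; apply: (ID); first exact: ideal_mulr.
  have XjE : mrestr W 'X_j = 'X_j :> {mpoly K[n]}.
    by rewrite /mrestr mmapX mmap1U jW.
  rewrite -XjE mulrC; apply: sr_ideal_mrestrM => //.
  by rewrite mcoeffX mnm1_eq0.
move/(sr_idealX K DeltaP); have -> : mnm_supp U_(j) = [set j].
  by apply/setP=> i; rewrite in_mnm_supp mnm1E inE (eq_sym i); case: (j == i).
by rewrite vertD.
Qed.

End Splitting.

(** Let a_1, a_2 be the W-parts of y_1, y_2. Modulo I, y_2 a_1 = a_2 a_1 = a_2 y_1, so regularity of
    y_2 gives a_1 = c y_1 modulo I for some c. Restricting to one side or the other, depending on
    whether c has a constant term, puts a part of y_1 into I. *)
Lemma depth_disconnected (W : {set 'I_n}) i j :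
  (forall F, F \in Delta -> (F \subset W) || (F \subset ~: W)) ->
  i \in W -> j \notin W -> enat_le (depth (max_homog_ideal n K) I) (Some 1%N).
Proof.
move=> splitW iW jW; apply: enat_sup_le => _ [ys [<- ym]].
case: ys ym => [|y1 [|y2 ys]] //= ym.
have iI := sr_ideal_ideal K Delta; have [I0 ID IM] := iI.
have y10 : y1@_0 = 0 by apply/mcoeff_max_homog_ideal/ym; rewrite inE eqxx.
have y20 : y2@_0 = 0.
  by apply/mcoeff_max_homog_ideal/ym; rewrite !inE eqxx orbT.
case/(regular_seq_cons iI) => reg1 /regular_seq_cons[]; first exact: ideal_gen_ideal.
have splitWC F : F \in Delta -> (F \subset ~: W) || (F \subset ~: ~: W).
  by rewrite setCK orbC; apply: splitW.
move=> /(_ (mrestr W y1)) reg2 _.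
have [c Ic] : exists c, I (mrestr W y1 - c * y1).
  have /reg2/(ideal_adjP iI)[d] : ideal_adj I [:: y1] (y2 * mrestr W y1).
    have [_ adjD adjM] := ideal_gen_ideal (I `|` [set` [:: y1]])%classic.
    rewrite -[_ * _](subrK (mrestr W y2 * y1)); apply: adjD; last first.
      by apply/adjM/ideal_gen_sub; right; rewrite /= inE.
    apply: ideal_adj_sub.
    have -> : y2 * mrestr W y1 - mrestr W y2 * y1 =
      (y2 - (mrestr W y2 + mrestr (~: W) y2)) * mrestr W y1
      - (y1 - (mrestr W y1 + mrestr (~: W) y1)) * mrestr W y2
      + mrestr W y1 * mrestr (~: W) y2 - mrestr W y2 * mrestr (~: W) y1.
      move: (mrestr W y1) (mrestr W y2) (mrestr (~: W) y1) (mrestr (~: W) y2).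
      by move=> a1 a2 b1 b2; ring.
    apply: ideal_sub => //; last exact: sr_ideal_mrestrM.
    apply: (ID); last exact: sr_ideal_mrestrM.
    by apply: ideal_sub => //; apply: ideal_mulr => //; apply: sr_ideal_split.
  by rewrite /= big_ord1 /= => Id; exists (d 0%N).
have nI1 := regular_mrestr_notin splitW iW y10 reg1.
have jW' : j \in ~: W by rewrite inE.
have nI2 := regular_mrestr_notin splitWC jW' y10 reg1.
suff: False by [].
(* If c has no constant term, restrict to W, where 1 - c has constant term 1. Otherwise restrict to
   the complement, where a_1 vanishes. *)
have [c0|c0] := eqVneq (mrestr (~: W) c)@_0 0.
  apply: nI1; apply: (@sr_ideal_coprime _ _ _ DeltaP _ (1 - mrestr W c)).
    rewrite mcoeffB mcoeff1 eqxx mcoeff_mrestr; move: c0.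
    by rewrite mcoeff_mrestr mnm_supp0 !sub0set => ->; rewrite subr0 oner_neq0.
  rewrite mulrBl mul1r; move/(sr_ideal_mrestr W): Ic.
  rewrite rmorphB rmorphM /=; congr (I (_ - _)).
  by apply/mpolyP=> m; rewrite !mcoeff_mrestr; case: (_ \subset W).
apply/nI2/(sr_ideal_coprime DeltaP c0).
move/(sr_ideal_mrestr (~: W)): Ic; rewrite rmorphB rmorphM /=.
rewrite [X in X - _](_ : _ = 0) ?sub0r => [/(ideal_opp iI)|]; first by rewrite opprK.
apply/mpolyP=> m; rewrite !mcoeff_mrestr mcoeff0; case: ifP => // mC.
case: ifP => // mW; suff -> : m = 0%MM by [].
apply/eqP; rewrite -mnm_supp_eq0 -subset0 -(setICr W) subsetI mW; exact: mC.
Qed.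

End Disconnected.

(** * Depth and dimension *)

Section MonomialsInRegularSequence.
Variables (K : fieldType) (R : comAlgType K).
Implicit Types (J : set R) (ys : seq R) (t : seq nat).

Fixpoint monomial_eval ys t : R :=
  match ys, t with
  | y :: ys', a :: t' => y ^+ a * monomial_eval ys' t'
  | _, _ => 1
  end.

Fixpoint box_exponents (k d : nat) : seq (seq nat) :=
  if d is d'.+1 then [seq a :: t | a <- iota 0 k, t <- box_exponents k d']
  else [:: [::]].

Lemma size_box_exponents k d : size (box_exponents k d) = (k ^ d)%N.
Proof. by elim: d => //= d IH; rewrite size_allpairs IH size_iota expnS. Qed.

Lemma box_exponents_uniq k d : uniq (box_exponents k d).
Proof.
elim: d => //= d IH; apply: allpairs_uniq => //; first exact: iota_uniq.
by move=> [a t] [b u] _ _ /= [-> ->].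
Qed.

Lemma box_exponentsP k d t :
  t \in box_exponents k d -> size t = d /\ all (fun a => (a < k)%N) t.
Proof.
elim: d t => [|d IH] t /=; first by rewrite inE => /eqP ->.
case/allpairsP=> -[a u] /= [ak /IH[<- uk] ->] /=.
by split; rewrite // uk andbT; rewrite mem_iota add0n in ak.
Qed.

(** Collect the sum by powers of the first element y. The lowest coefficient lies in J + (y), so it
    vanishes by induction on the sequence; then y can be cancelled and the next power becomes the
    lowest. *)
Lemma regular_seq_monomials_free J ys k (c : seq nat -> K) :
  ideal_set J -> regular_seq J ys ->
  J (\sum_(t <- box_exponents k (size ys)) c t *: monomial_eval ys t) ->
  {in box_exponents k (size ys), forall t, c t = 0}.
Proof.
elim: ys J c => [|y ys IH] J c iJ Jreg /=.
  rewrite big_seq1 => Jc t; rewrite inE => /eqP ->.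
  apply: contra_notP (Jreg.2) => /eqP c0; apply: ideal_adj_sub.
  have [_ _ JM] := iJ; have := JM ((c [::])^-1%:A) _ Jc.
  by rewrite -scalerAl mul1r scalerA mulVf // scale1r.
have [yreg yseq] := regular_seq_cons iJ Jreg.
pose g (b : nat) :=
  \sum_(t <- box_exponents k (size ys)) c (b :: t) *: monomial_eval ys t.
rewrite big_allpairs_dep /= => Jsum.
have {Jsum}: J (\sum_(a <- iota 0 k) y ^+ a * g a).
  congr J: Jsum; apply: eq_bigr => a _; rewrite mulr_sumr.
  by apply: eq_bigr => t _; rewrite scalerAr.
suff main j s : J (\sum_(a <- iota s j) y ^+ (a - s) * g a) ->
    forall a t, (s <= a < s + j)%N -> t \in box_exponents k (size ys) -> c (a :: t) = 0.
  move=> Jsum _ /allpairsP[[a t] /= [ak tk ->]]; apply: (main k 0%N) => //.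
    by congr J: Jsum; apply: eq_bigr => b _; rewrite subn0.
  by rewrite mem_iota in ak.
elim: j s => [|j IHj] s; first by move=> _ a t; rewrite addn0 leqNgt => /andP[/negP].
rewrite /= big_cons subnn expr0 mul1r => Jsum.
have shift : \sum_(a <- iota s.+1 j) y ^+ (a - s) * g a =
    y * \sum_(a <- iota s.+1 j) y ^+ (a - s.+1) * g a.
  rewrite mulr_sumr !big_seq; apply: eq_bigr => a; rewrite mem_iota => /andP[sa _].
  by rewrite mulrA -exprS -subSn // subSS.
rewrite shift in Jsum.
have gs : {in box_exponents k (size ys), forall t, c (s :: t) = 0}.
  apply: (IH (ideal_adj J [:: y]) (fun t => c (s :: t))) => //.
    exact: ideal_gen_ideal.
  have iJy := ideal_gen_ideal (J `|` [set` [:: y]])%classic.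
  rewrite -/(g s) -[g s](addrK (y * \sum_(a <- iota s.+1 j) y ^+ (a - s.+1) * g a)).
  apply: (ideal_sub iJy); first exact: ideal_adj_sub.
  by apply: (ideal_mulr _ iJy); apply: ideal_gen_sub; right; rewrite /= inE.
have gs0 : g s = 0 by rewrite /g big_seq big1 // => t /gs ->; rewrite scale0r.
rewrite gs0 add0r in Jsum; move/yreg/IHj: Jsum => {}IHj a t.
rewrite leq_eqVlt => /andP[/orP[/eqP <- _|sa aj]]; first exact: gs.
by apply: IHj; rewrite sa addSnnS.
Qed.

End MonomialsInRegularSequence.

Section DepthDimension.
Variables (n : nat) (K : fieldType).
Implicit Types (m : 'X_{1..n}) (p q : {mpoly K[n]}) (ys : seq {mpoly K[n]}).

Definition mdeg_le p (d : nat) := forall m, p@_m != 0 -> (mdeg m <= d)%N.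

Lemma mdeg_leM p q d e : mdeg_le p d -> mdeg_le q e -> mdeg_le (p * q) (d + e).
Proof.
move=> pd qe m /mcoeffM_neq0[m1 [m2 [-> /pd m1d /qe m2e]]].
by rewrite mdegD leq_add.
Qed.

Lemma mdeg_le1 : mdeg_le 1 0.
Proof.
by move=> m; rewrite mcoeff1; case: (m =P 0%MM) => [->|_]; rewrite ?mdeg0 ?eqxx.
Qed.

Lemma mdeg_leX p d a : mdeg_le p d -> mdeg_le (p ^+ a) (a * d).
Proof.
move=> pd; elim: a => [|a IH]; first exact: mdeg_le1.
by rewrite exprS mulSn; apply: mdeg_leM.
Qed.

Lemma mdeg_le_monomial_eval ys t b k :
  (forall y, y \in ys -> mdeg_le y b) -> all (fun a => a < k)%N t ->
  mdeg_le (monomial_eval ys t) (size ys * (k * b)).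
Proof.
elim: ys t => [|y ys IH] [|a t] /= yb; try by move=> _ m /mdeg_le1 /leq_trans; apply.
case/andP=> ak tk; rewrite mulSn; apply: mdeg_leM; last first.
  by apply: IH => // z zys; apply: yb; rewrite inE zys orbT.
move=> m /(mdeg_leX (yb y (mem_head _ _))) /leq_trans; apply.
by rewrite leq_mul2r (ltnW ak) orbT.
Qed.

Variable Delta : {set {set 'I_n}}.
Hypothesis DeltaP : simplicial_complex Delta.

Definition box_faces (N : nat) : {set {ffun 'I_n -> 'I_N.+1}} :=
  [set h : {ffun 'I_n -> 'I_N.+1} | [set i | h i != ord0] \in Delta].

Lemma card_box_faces N e : (forall F, F \in Delta -> (#|F| <= e)%N) ->
  (#|box_faces N| <= #|Delta| * N.+1 ^ e)%N.
Proof.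
move=> De; rewrite -sum1_card.
rewrite (partition_big (fun h : {ffun 'I_n -> 'I_N.+1} => [set i | h i != ord0])
  (mem Delta)) /=; last first.
  by move=> h; rewrite inE.
rewrite -sum_nat_const; apply: leq_sum => F FD; rewrite sum1_card.
have -> : (N.+1 ^ e = #|'I_N.+1| ^ e)%N by rewrite card_ord.
apply: (@leq_trans (#|'I_N.+1| ^ #|F|)); last first.
  by rewrite card_ord leq_pexp2l // De.
rewrite -(card_pffun_on ord0 (mem F) (mem 'I_N.+1)); apply: subset_leq_card.
apply/fintype.subsetP => h; rewrite inE => /andP[_ /eqP <-].
apply/pffun_onP; split; last by move=> ? /imageP[].
by apply/fintype.subsetP => i; rewrite !inE.
Qed.

(** If d > e, the k^d monomials in the sequence outnumber, for large k, the face monomials with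
    exponents at most N, since N grows linearly in k. A dependency of their coefficients contradicts
    [regular_seq_monomials_free]. *)
Lemma depth_le_dim e : (forall F, F \in Delta -> (#|F| <= e)%N) ->
  enat_le (depth (max_homog_ideal n K) (sr_ideal K Delta)) (Some e).
Proof.
move=> De; apply: enat_sup_le => _ [ys [<- _ yreg]]; rewrite leqNgt; apply/negP => lt_e.
set d := size ys in lt_e *; pose b := (\sum_(y <- ys) msize y)%N.
(* As N + 1 <= k (d b + 1), this choice gives |Delta| (N + 1)^e < k^(e + 1) <= k^d. *)
pose k := (#|Delta| * (d * b).+1 ^ e).+1.
pose N := (d * (k * b))%N; pose box := box_exponents k d.
pose mon i : {mpoly K[n]} := monomial_eval ys (nth [::] box i).
have mon_deg (i : 'I_(size box)) : mdeg_le (mon i) N.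
  have /box_exponentsP[_ ik] : nth [::] box i \in box by apply: mem_nth.
  apply: mdeg_le_monomial_eval ik => y yys m; rewrite -mcoeff_msupp.
  move/msize_mdeg_lt/ltnW/leq_trans; apply.
  by rewrite /b (big_rem y) //= leq_addr.
have lt_box : (#|box_faces N| < size box)%N.
  rewrite size_box_exponents; apply: leq_ltn_trans (card_box_faces N De) _.
  apply: (@leq_trans (k ^ e.+1)); last by rewrite leq_pexp2l.
  apply: (@leq_ltn_trans (#|Delta| * (k * (d * b).+1) ^ e)).
    rewrite leq_mul2l; apply/orP; right; have [->|e0] := posnP e; first by [].
    rewrite leq_exp2r // /N.
    by rewrite mulnS mulnCA -[X in (X < _)%N]add0n; apply: leq_add.
  by rewrite expnMn mulnCA expnS mulnC ltn_pmul2r ?expn_gt0.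
pose mnm (j : 'I_#|box_faces N|) : 'X_{1..n} := [multinom (enum_val j i : nat) | i < n].
pose A := \matrix_(i < size box, j < #|box_faces N|) (mon i)@_(mnm j).
have /rowV0Pn[v /sub_kermxP vA v0] : kermx A != 0.
  rewrite kermx_eq0 /row_free; apply: contraL lt_box => /eqP <-.
  by rewrite -leqNgt rank_leq_col.
pose c t := oapp (v 0) 0 (insub (index t box)).
have cE (i : 'I_(size box)) : c (nth [::] box i) = v 0 i.
  by rewrite /c index_uniq ?box_exponents_uniq // valK.
have sumE : \sum_(t <- box) c t *: monomial_eval ys t =
    \sum_(i < size box) v 0 i *: mon i.
  by rewrite (big_nth [::]) big_mkord; apply: eq_bigr => i _; rewrite cE.
suff Isum : sr_ideal K Delta (\sum_(t <- box) c t *: monomial_eval ys t).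
  have c0 := regular_seq_monomials_free (sr_ideal_ideal K Delta) yreg Isum.
  case/negP: v0; apply/eqP/rowP => i; rewrite mxE -cE.
  by apply: c0; apply: mem_nth.
rewrite sumE; apply/(sr_idealP DeltaP) => m; apply: contraNN => mD; apply/eqP.
rewrite raddf_sum /=; have [mN|] := boolP [forall i, m i <= N]%N.
  have hm : [ffun i => inord (m i)] \in box_faces N.
    rewrite inE; apply: etrans mD; congr (_ \in Delta); apply/setP=> i.
    by rewrite !inE ffunE -val_eqE /= inordK // ltnS (forallP mN).
  have mE : m = mnm (enum_rank_in hm [ffun i => inord (m i)]).
    apply/mnmP=> i; rewrite mnmE enum_rankK_in // ffunE inordK // ltnS.
    exact: (forallP mN).
  move/rowP/(_ (enum_rank_in hm [ffun i => inord (m i)])): vA.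
  rewrite !mxE => vA; rewrite -[RHS]vA; apply: eq_bigr => i _.
  by rewrite mcoeffZ [m in LHS]mE mxE.
(* A monomial with an exponent above N has too large a degree to occur in any [mon i]. *)
rewrite negb_forall => /existsP[j]; rewrite -ltnNge => Nj.
apply: big1 => i _; rewrite mcoeffZ; apply/eqP; rewrite mulf_eq0; apply/orP; right.
apply: contraLR Nj => /mon_deg; rewrite -leqNgt; apply: leq_trans.
by rewrite mdegE (bigD1 j) //= leq_addr.
Qed.

End DepthDimension.

(** * Stanley decompositions from interval partitions *)

Section StanleyIntervals.
Variables (n : nat) (K : fieldType).
Implicit Types (m : 'X_{1..n}) (f g : {mpoly K[n]}) (A B F G : {set 'I_n}).

Definition mfilter (P : pred 'X_{1..n}) f : {mpoly K[n]} :=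
  \sum_(m <- msupp f | P m) f@_m *: 'X_[m].

Lemma mcoeff_mfilter P f m : (mfilter P f)@_m = if P m then f@_m else 0.
Proof.
rewrite /mfilter raddf_sum /=; under eq_bigr do rewrite mcoeffZ mcoeffX.
have [mf|] := boolP (m \in msupp f); last first.
  move=> mf; have -> : f@_m = 0 by apply/eqP; rewrite mcoeff_eq0.
  rewrite if_same big_seq_cond big1 // => k /andP[kf _].
  by case: (k =P m) => [km|_]; rewrite ?mulr0 //; rewrite km (negbTE mf) in kf.
rewrite big_mkcond (bigD1_seq m) //= big1 ?addr0 => [|k /negbTE km].
  by rewrite eqxx mulr1.
by rewrite km mulr0 if_same.
Qed.

(** This matches the interval [A, B] of faces with the Stanley space x_A K[B]: a monomial belongs to
    it exactly when its support lies in the interval. *)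
Lemma stanley_space_squarefreeP A B f : A \subset B ->
  stanley_space (mnm_ind A) B f <->
  forall m, f@_m != 0 -> (A \subset mnm_supp m) && (mnm_supp m \subset B).
Proof.
move=> AB; split=> [[g gB ->] m /mcoeffM_neq0[m1 [m2 [->]]]|fAB].
  rewrite mcoeffX; case: (_ =P m1) => [<- _|_]; rewrite ?eqxx // => gm2.
  rewrite mnm_suppD mnm_supp_ind subsetUl subUset AB.
  apply/fintype.subsetP => i; rewrite in_mnm_supp; apply: gB.
  by rewrite mcoeff_msupp.
exists (\sum_(m <- msupp f) f@_m *: 'X_[m - mnm_ind A]).
  move=> m i /msupp_sum_le /flatten_mapP[k]; rewrite mem_filter /= => kf.
  move=> /msuppZ_le; rewrite msuppX inE => /eqP ->.
  rewrite mnmBE => ki; rewrite mcoeff_msupp in kf.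
  have /andP[_ /fintype.subsetP] := fAB _ kf; apply; rewrite in_mnm_supp.
  by apply: contraNneq ki => ->.
rewrite [LHS]mpolyE mulr_sumr !big_seq; apply: eq_bigr => m.
rewrite mcoeff_msupp => /fAB/andP[Am _].
by rewrite -scalerAr -mpolyXD addmC submK // mnm_ind_le.
Qed.

Variable Delta : {set {set 'I_n}}.
Hypothesis DeltaP : simplicial_complex Delta.

(* The intervals [lo F, hi F], for F in Delta, partition Delta. *)
Lemma sdepth_interval_partition (lo hi : {set 'I_n} -> {set 'I_n}) (d : nat) :
  (d <= n)%N ->
  (forall F, F \in Delta ->
     [/\ lo F \subset F, F \subset hi F, hi F \in Delta & (d <= #|hi F|)%N]) ->
  (forall F G, F \in Delta -> G \in Delta -> lo G \subset F -> F \subset hi G ->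
     lo F = lo G /\ hi F = hi G) ->
  enat_le (Some d) (sdepth (sr_ideal K Delta)).
Proof.
move=> dn lohi part; set I := sr_ideal K Delta.
(* Taking the set of pairs counts each interval once, although it arises from all of its faces. *)
pose P := [set (lo F, hi F) | F in Delta].
pose u (i : 'I_#|P|) := mnm_ind (enum_val i).1.
pose Z (i : 'I_#|P|) := (enum_val i).2.
have PP (i : 'I_#|P|) : exists2 F, F \in Delta & enum_val i = (lo F, hi F).
  by have /imsetP[F FD ->] := enum_valP i; exists F.
have Zsub (i : 'I_#|P|) : (enum_val i).1 \subset Z i.
  rewrite /Z; have [F /lohi[loF Fhi _ _] ->] := PP i.
  by apply: fintype.subset_trans Fhi.
have ZD i : Z i \in Delta.
  by rewrite /Z; have [F /lohi[_ _ hiD _] ->] := PP i.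
have mem_stanley i f := stanley_space_squarefreeP f (Zsub i).
have intervalP (i : 'I_#|P|) F :
    F \in Delta -> (enum_val i).1 \subset F -> F \subset Z i ->
    enum_val i = (lo F, hi F).
  rewrite /Z; have [G GD ->] := PP i => FD loF Fhi.
  by have [-> ->] := part F G FD GD loF Fhi.
apply: (@enat_le_trans _ (Some (sdepth_decomposition Z))); last first.
  apply: enat_sup_ge; exists #|P|, u, Z; split=> //; split.
    move=> i v vZ; rewrite -mpolyXD => /(sr_idealX K DeltaP).
    rewrite mnm_suppD mnm_supp_ind => /negP; apply; apply: DeltaP (ZD i) _.
    rewrite subUset Zsub; apply/fintype.subsetP => j; rewrite in_mnm_supp.
    by apply: vZ; rewrite msuppX inE.
  split=> [f|w wV /(sr_idealP DeltaP) wI i].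
    (* The i-th component of f collects the monomials whose support lies in the i-th interval. *)
    pose Q (i : 'I_#|P|) m := (mnm_supp m \in Delta) &&
      ((lo (mnm_supp m), hi (mnm_supp m)) == enum_val i).
    exists (fun i => mfilter (Q i) f).
      move=> i; apply/mem_stanley => m; rewrite mcoeff_mfilter.
      case: ifP; rewrite ?eqxx // => /andP[/lohi[loF Fhi _ _] /eqP E] _.
      by rewrite /Z -E /= loF Fhi.
    apply/(sr_idealP DeltaP) => m; apply: contraNN => mD.
    have mP : (lo (mnm_supp m), hi (mnm_supp m)) \in P.
      by apply/imsetP; exists (mnm_supp m).
    rewrite mcoeffB raddf_sum.
    rewrite (bigD1 (enum_rank_in mP (lo (mnm_supp m), hi (mnm_supp m)))) //=.
    rewrite mcoeff_mfilter /Q mD enum_rankK_in // eqxx /= big1 ?addr0 ?subrr // => j jP.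
    rewrite mcoeff_mfilter /Q mD /=; case: eqP => // E.
    by case/negP: jP; apply/eqP/enum_val_inj; rewrite enum_rankK_in // E.
  apply/(sr_idealP DeltaP) => m wm; apply: contraT; rewrite negbK => mD.
  have/wI: (\sum_i w i)@_m != 0.
    rewrite raddf_sum (bigD1 i) //= big1 ?addr0 // => j ji.
    apply: contraNeq ji => wjm; apply/eqP/enum_val_inj.
    have /mem_stanley/(_ m wm)/andP[Ai Bi] := wV i.
    have /mem_stanley/(_ m wjm)/andP[Aj Bj] := wV j.
    by rewrite (intervalP i _ mD Ai Bi) (intervalP j _ mD Aj Bj).
  by rewrite mD.
rewrite /= /sdepth_decomposition; apply: (big_ind (fun x => d <= x)%N) => //.
  by move=> x y dx dy; rewrite leq_min dx.
by move=> i _; rewrite /Z; have [F /lohi[_ _ _ dF] ->] := PP i.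
Qed.

End StanleyIntervals.

(** * Circuits of a complex and of its vertex links *)

Section LocallyDisjointCircuits.
Variables (T : finType) (Delta : {set {set T}}).
Hypothesis DeltaP : forall F G : {set T}, F \in Delta -> G \subset F -> G \in Delta.
Hypothesis vertD : forall v : T, [set v] \in Delta.
Implicit Types (a b c v w x y : T) (B C D E F : {set T}).

Definition circuit C := minset (fun F : {set T} => F \notin Delta) C.

(** These are the minimal nonfaces of the link of v, and the supports of the generators once x_v is
    inverted. A vertex not joined to v counts as a singleton circuit. *)
Definition link_circuit v C := minset (fun F : {set T} => v |: F \notin Delta) C.

Definition adj a b := (a != b) && ([set a; b] \in Delta).

Definition circuits_disjoint := forall C D x,
  circuit C -> circuit D -> x \in C -> x \in D -> C = D.

Definition link_circuits_disjoint := forall v C D x,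
  link_circuit v C -> link_circuit v D -> x \in C -> x \in D -> C = D.

Lemma adj_sym a b : adj a b = adj b a.
Proof. by rewrite /adj eq_sym setUC. Qed.

Lemma face_adj F a b : F \in Delta -> a \in F -> b \in F -> a != b -> adj a b.
Proof.
move=> FD aF bF ab; rewrite /adj ab; apply: DeltaP FD _.
by rewrite subUset !sub1set aF.
Qed.

Lemma circuit_link C v : circuit C -> v \in C -> link_circuit v (C :\ v).
Proof.
move=> /minsetP[CN Cmin] vC; apply/minsetP; rewrite setD1K //; split=> // B vB BC.
have vNB : v \notin B by apply/negP => /(fintype.subsetP BC); rewrite !inE eqxx.
rewrite -(Cmin (v |: B)) ?setU1K // subUset sub1set vC.
exact: fintype.subset_trans BC (subD1set _ _).
Qed.

Lemma link_circuit2 a b c : adj b a -> adj b c -> a != c ->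
  b |: [set a; c] \notin Delta -> link_circuit b [set a; c].
Proof.
move=> /andP[_ ba] /andP[_ bc] ac N; apply/minsetP; split=> // B NB sB.
apply/eqP; rewrite eqEsubset sB subUset !sub1set /=; apply/andP; split.
  apply: contraR NB => aB; apply: DeltaP bc _; rewrite setUS //.
  apply/fintype.subsetP=> x xB; have := fintype.subsetP sB x xB; rewrite !inE.
  by case/orP=> // /eqP xa; rewrite -xa xB in aB.
apply: contraR NB => cB; apply: DeltaP ba _; rewrite setUS //.
apply/fintype.subsetP=> x xB; have := fintype.subsetP sB x xB; rewrite !inE.
by case/orP=> // /eqP xa; rewrite -xa xB in cB.
Qed.

Hypothesis link_disj : link_circuits_disjoint.

(** Otherwise {a, c} and {a, w} would be distinct circuits of the link of b sharing a. *)
Lemma link_circuit2_unique a b c w : adj b a -> adj b c -> adj b w ->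
  a != c -> a != w -> w != c ->
  b |: [set a; c] \notin Delta -> b |: [set a; w] \in Delta.
Proof.
move=> ba bc bw ac aw wc N; apply: contraT => Nw.
have := link_disj (link_circuit2 ba bc ac N) (link_circuit2 ba bw aw Nw)
  (set21 a c) (set21 a w).
by move/setP/(_ w); rewrite !inE eqxx orbT (negbTE wc) eq_sym (negbTE aw).
Qed.

Lemma common_nonadj a b c w : adj b a -> adj b c -> adj b w ->
  a != c -> ~~ adj a c -> w != a -> w != c -> adj a w.
Proof.
move=> ba bc bw ac N wa wc; have aw : a != w by rewrite eq_sym.
rewrite /adj aw; apply: (@DeltaP (b |: [set a; w])); last exact: subsetUr.
apply: (link_circuit2_unique ba bc) => //.
apply: contra N => /DeltaP NN; rewrite /adj ac; apply: NN; exact: subsetUr.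
Qed.

Definition triangle_free v := [forall (F | (F \in Delta) && (v \in F)), #|F| <= 2]%N.

Lemma card_set3 a b c : a != b -> a != c -> b != c -> #|a |: [set b; c]| = 3.
Proof. by move=> ab ac bc; rewrite cardsU1 !inE (negbTE ab) (negbTE ac) cards2 bc. Qed.

Lemma two_more F v : v \in F -> (2 < #|F|)%N ->
  exists u u', [/\ u \in F, u' \in F, u != v, u' != v & u != u'].
Proof.
move=> vF F3; have : (1 < #|F :\ v|)%N by move: F3; rewrite (cardsD1 v) vF.
case/card_gt1P => u [u' []]; rewrite !inE => /andP[uv uF] /andP[u'v u'F] uu'.
by exists u, u'.
Qed.

(** If w lay in a triangle with u and u', then {v, u} and {v, u'} would be two circuits of its link
    sharing v. *)
Lemma triangle_free_adj v w : adj v w -> triangle_free v -> triangle_free w.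
Proof.
move=> vw /forall_inP Qv; apply/forall_inP => F /andP[FD wF]; rewrite leqNgt.
apply/negP => F3; have vF : v \notin F.
  by apply/negP => vF; have := Qv F; rewrite FD vF leqNgt F3 => /(_ isT).
have [u [u' [uF u'F uw u'w uu']]] := two_more wF F3.
have [vNu vNu'] : v != u /\ v != u'.
  by split; apply: contraNneq vF => ->.
have [vNw _] := andP vw; have wNv : w != v by rewrite eq_sym.
have Q3 x : x != w -> v != x -> w |: [set v; x] \notin Delta.
  move=> xw vx; apply/negP => D3; have := Qv (w |: [set v; x]).
  by rewrite D3 !inE eqxx orbT card_set3 //= ?[w == x]eq_sym // => /(_ isT).
have wu x : x \in F -> x != w -> adj w x.
  by move=> xF xw; apply: (face_adj FD) => //; rewrite eq_sym.
have wv : adj w v by rewrite adj_sym.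
have := link_circuit2_unique wv (wu u uF uw) (wu u' u'F u'w) vNu vNu'.
rewrite eq_sym => /(_ uu' (Q3 u uw vNu)) D3.
by have := Q3 u' u'w vNu'; rewrite D3.
Qed.

Lemma connected_triangle_free v : (forall w, connect adj v w) ->
  triangle_free v -> forall F, F \in Delta -> (#|F| <= 2)%N.
Proof.
move=> conn Qv F FD; have [->|/set0Pn[w wF]] := eqVneq F set0; first by rewrite cards0.
have : triangle_free w.
  case/connectP: (conn w) => p; elim: p v Qv {conn} => [|y p IH] v Qv /=.
    by move=> _ ->.
  by case/andP=> /triangle_free_adj/(_ Qv)/IH; apply.
by move/forall_inP; apply; rewrite FD.
Qed.

Hypothesis conn : forall v w, connect adj v w.
Hypothesis triangles : forall v, ~~ triangle_free v.

(** A triangle at b contains a vertex other than a, b, c, because a and c are not joined;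
    [common_nonadj] joins it to both. *)
Lemma third_neighbour a b c : adj b a -> adj b c -> a != c -> ~~ adj a c ->
  exists w, [/\ adj b w, adj w a & adj w c].
Proof.
move=> ba bc ac N; have ca : c != a by rewrite eq_sym.
have Nca : ~~ adj c a by rewrite adj_sym.
suff [w [bw wa wc]] : exists w, [/\ adj b w, w != a & w != c].
  exists w; split=> //; rewrite adj_sym; first exact: (common_nonadj ba bc bw).
  exact: (common_nonadj bc ba bw).
have : ~~ triangle_free b by [].
rewrite negb_forall_in => /exists_inP[F /andP[FD bF]]; rewrite -ltnNge => F3.
have [u [u' [uF u'F ub u'b uu']]] := two_more bF F3.
have bu x : x \in F -> x != b -> adj b x.
  by move=> xF xb; apply: (face_adj FD) => //; rewrite eq_sym.
have uu'adj : adj u u' by apply: (face_adj FD).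
have [ua|ua] := eqVneq u a.
  exists u'; split; [exact: bu | by rewrite -ua eq_sym |].
  by apply: contraNneq N => <-; rewrite -ua.
have [uc|uc] := eqVneq u c; last by exists u; split=> //; exact: bu.
exists u'; split; [exact: bu | | by rewrite -uc eq_sym].
by apply: contraNneq N => <-; rewrite -uc adj_sym.
Qed.

(** The ball of radius 2 is closed under adjacency. For a path v, z, y, e with v, y not joined, take
    u joined to z, v and y. If e is not joined to z, then in the link of y it must be joined to
    u. *)
Lemma diameter2 v w : v != w -> ~~ adj v w -> exists2 u, adj v u & adj u w.
Proof.
pose near y := [|| y == v, adj v y | [exists z, adj v z && adj z y]].
suff : near w.
  case/or3P=> [/eqP ->|->//|/existsP[z /andP[vz zw]] _ _]; last by exists z.
  by rewrite eqxx.
have step y e : near y -> adj y e -> near e.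
  move=> ny ye; apply/or3P; have [|ev] := eqVneq e v; first by constructor 1.
  case/or3P: ny => [/eqP yv|vy|/existsP[z /andP[vz zy]]].
  - by constructor 2; rewrite -yv.
  - by constructor 3; apply/existsP; exists y; rewrite vy.
  have [yv|yv] := eqVneq y v; first by constructor 2; rewrite -yv.
  have [vy|Nvy] := boolP (adj v y).
    by constructor 3; apply/existsP; exists y; rewrite vy.
  have [ze|Nze] := boolP (adj z e).
    by constructor 3; apply/existsP; exists z; rewrite vz.
  have [->|zNe] := eqVneq e z; first by constructor 2.
  have zv : adj z v by rewrite adj_sym.
  have vNy : v != y by rewrite eq_sym.
  have [u [zu uv uy]] := third_neighbour zv zy vNy Nvy.
  constructor 3; apply/existsP; exists u; rewrite adj_sym uv adj_sym.
  have yz : adj y z by rewrite adj_sym.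
  have yu : adj y u by rewrite adj_sym.
  apply: (common_nonadj ye yz yu) => //; first by rewrite adj_sym.
    by apply: contraNneq Nze => <-.
  by have /andP[] := zu; rewrite eq_sym.
have nearv : near v by rewrite /near eqxx.
have main p x : near x -> path adj x p -> near (last x p).
  by elim: p x => //= y p IH x nx /andP[xy]; apply: IH; apply: step nx xy.
by case/connectP: (conn v w) => p vp ->; apply: main.
Qed.

(** The complement of the graph is a matching. If a and b differed, v, a and b could have no common
    neighbour; yet one is built, starting from midpoints u of v, a and t of v, b and a vertex w
    joined to u, v and a. *)
Lemma nonadj_unique v a b : v != a -> v != b -> ~~ adj v a -> ~~ adj v b -> a = b.
Proof.
move=> va vb Nva Nvb; apply/eqP; apply: contraT => ab.
have av : a != v by rewrite eq_sym.
have bv : b != v by rewrite eq_sym.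
have ba : b != a by rewrite eq_sym.
have no_common s : adj s v -> adj s a -> adj s b -> false.
  by move=> sv sa sb; rewrite -(negbTE Nvb); apply: (common_nonadj sv sa).
have [u vu ua] := diameter2 va Nva; have [t vt tb] := diameter2 vb Nvb.
have uv : adj u v by rewrite adj_sym.
have tv : adj t v by rewrite adj_sym.
have ta : t != a by apply: contraNneq Nva => <-.
have [/andP[tNv _] /andP[uNv _]] := conj tv uv.
have Nta : ~~ adj t a by apply/negP => ta'; have := no_common t tv ta' tb.
have Nut : ~~ adj u t.
  apply: contra Nta => ut; rewrite adj_sym.
  by apply: (common_nonadj ua uv) => //; rewrite adj_sym.
have [w [uw wv wa]] := third_neighbour uv ua va Nva.
have vw : adj v w by rewrite adj_sym.
have ut : u != t by apply: contraNneq Nta => <-.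
have wu : w != u by have /andP[] := uw; rewrite eq_sym.
have wt : w != t by apply: contraNneq Nta => <-.
have tu : t != u by rewrite eq_sym.
have tw : adj t w by apply: (common_nonadj vt vu) => //; rewrite adj_sym.
have bw : adj b w.
  apply: (common_nonadj tb tv tw) => //; first by rewrite adj_sym.
    by apply: contraNneq Nvb => <-.
  by have /andP[] := wv.
by apply: (no_common w wv wa); rewrite adj_sym.
Qed.

Lemma circuit_other C x : circuit C -> x \in C -> exists2 c, c \in C & c != x.
Proof.
move=> /minsetP[CN _] xC; apply/exists_inP; apply: contraNT CN.
rewrite negb_exists_in => /forall_inP Cx; apply: DeltaP (vertD x) _.
by apply/fintype.subsetP => c /Cx; rewrite negbK inE.
Qed.

Lemma circuit_sub C D : circuit C -> circuit D -> C \subset D -> C = D.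
Proof. by move=> /minsetP[CN _] /minsetP[_ Dmin] /Dmin; apply. Qed.

(** Removing x gives two circuits of the link of x that share y. *)
Lemma circuit_inter C D x y : circuit C -> circuit D ->
  x \in C -> x \in D -> y \in C -> y \in D -> y != x -> C = D.
Proof.
move=> Cc Dc xC xD yC yD yx; rewrite -(setD1K xC) -(setD1K xD); congr (_ |: _).
apply: (link_disj (x := y) (circuit_link Cc xC) (circuit_link Dc xD)).
  by rewrite !inE yx.
by rewrite !inE yx.
Qed.

(** If D avoids c, any other vertex v of D is joined to x and to c by the matching property. Then
    {x, c} and D minus v are circuits of the link of v sharing x. *)
Lemma circuit_edge c x D : x != c -> circuit [set x; c] -> circuit D ->
  x \in D -> [set x; c] = D.
Proof.
move=> xc Cc Dc xD; apply/eqP; apply: contraT => CD.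
have cD : c \notin D.
  apply: contra CD => cD; apply/eqP/circuit_sub => //.
  by rewrite subUset !sub1set xD.
have Nxc : ~~ adj x c by rewrite /adj xc; have /minsetP[] := Cc.
have [v vD vx] := circuit_other Dc xD.
have cv : c != v by apply: contraNneq cD => ->.
have vc : adj v c.
  apply: contraT; rewrite adj_sym => Ncv; rewrite -(negbTE vx); apply/eqP/esym.
  by apply: (@nonadj_unique c) => //; rewrite 1?eq_sym // adj_sym.
have vxadj : adj v x.
  apply: contraT => Nvx; rewrite -(negbTE cv); apply/eqP.
  by apply: (@nonadj_unique x) => //; rewrite 1?eq_sym // adj_sym.
have := link_disj (link_circuit2 vxadj vc xc _) (circuit_link Dc vD) (set21 x c).
rewrite !inE eq_sym vx xD => /(_ _ isT) E; case/negP: cD.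
have : c \in D :\ v.
  rewrite -E ?set22 //; have /minsetP[N _] := Cc; apply: contra N => /DeltaP; apply.
  exact: subsetUr.
by rewrite !inE => /andP[].
Qed.

Lemma circuits_disjointP : circuits_disjoint.
Proof.
move=> C D v Cc Dc vC vD; apply/eqP; apply: contraT => CD.
have interv x : x \in C -> x \in D -> x = v.
  move=> xC xD; apply/eqP; apply: contraNT CD => xv.
  by apply/eqP/(circuit_inter Cc Dc vC vD xC xD).
have [w wC wv] := circuit_other Cc vC.
have wD : w \notin D by apply: contra wv => /(interv w wC) ->.
have wDN : w |: D \notin Delta.
  have /minsetP[DN _] := Dc; apply: contra DN => /DeltaP; apply; exact: subsetUr.
(* For w in C outside D, a link circuit E of w inside D yields a third circuit, E with w added.
   Comparing it with C if E is a point, and with D otherwise, gives the contradiction. *)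
have [E Ew ED] := minset_exists (P := fun F : {set T} => w |: F \notin Delta) wDN.
have wE : w \notin E by apply: contra wD; exact: fintype.subsetP.
have vE : v \notin E.
  apply: contra CD => vE.
  have EC : E = C :\ w.
    by apply: (link_disj Ew (circuit_link Cc wC) vE); rewrite !inE eq_sym wv.
  have CE : C = [set v; w].
    apply/setP=> x; rewrite !inE; apply/idP/orP=> [xC|[] /eqP -> //].
    have [->|xw] := eqVneq x w; [by right | left; apply/eqP/interv => //].
    by apply: (fintype.subsetP ED); rewrite EC !inE xw.
  by rewrite CE; apply/eqP/circuit_edge => //; rewrite -?CE // eq_sym.
have EF : E \in Delta.
  apply: contraT => EN; have /minsetP[_ Dmin] := Dc.
  by move: vE; rewrite (Dmin E EN ED) vD.
have C'c : circuit (w |: E).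
  have /minsetP[EN Emin] := Ew; apply/minsetP; split=> // B BN BE.
  have wB : w \in B.
    apply: contraR BN => wB; apply: DeltaP EF _; apply/fintype.subsetP=> x xB.
    have := fintype.subsetP BE x xB; rewrite !inE => /orP[/eqP xw|//].
    by rewrite -xw xB in wB.
  rewrite -(setD1K wB); congr (_ |: _); apply: Emin; rewrite ?setD1K //.
  by rewrite subDset.
have [e eE ew] : exists2 e, e \in E & e != w.
  have [e] := circuit_other C'c (setU11 w E).
  by rewrite !inE => /orP[/eqP -> /eqP|] //; exists e.
have eD := fintype.subsetP ED e eE.
have [E1|[e' e'E e'e]] : E = [set e] \/ exists2 e', e' \in E & e' != e.
  have [/exists_inP[e' ? ?]|] := boolP [exists e' in E, e' != e].
    by right; exists e'.
  rewrite negb_exists_in => /forall_inP E1; left; apply/setP=> x; rewrite inE.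
  by apply/idP/eqP=> [/E1/negPn/eqP|->].
  have C'C : w |: E = C.
    by move: C'c; rewrite E1 => C'c; apply: circuit_edge => //; rewrite eq_sym.
  have eC : e \in C by rewrite -C'C !inE eE orbT.
  by move: vE; rewrite -(interv e eC eD) eE.
have C'D : w |: E = D.
  apply: (circuit_inter (x := e) (y := e') C'c Dc) => //.
  - by rewrite inE eE orbT.
  - by rewrite inE e'E orbT.
  exact: (fintype.subsetP ED).
by move: wD; rewrite -C'D setU11.
Qed.

End LocallyDisjointCircuits.

(** * Complete intersections and localization *)

Section ConormalModule.
Variable R : comNzRingType.
Implicit Types (ys zs : seq R).

Lemma ideal_set0 : ideal_set ([set 0] : set R)%classic.
Proof.
split=> [//|f g -> ->|a f ->]; first by rewrite /= addr0.
by rewrite /= mulr0.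
Qed.

Lemma ideal_gen_seqP zs f : ideal_gen [set` zs]%classic f ->
  exists d : nat -> R, f = \sum_(i < size zs) d i * zs`_i.
Proof.
move=> fzs; have /(ideal_adjP ideal_set0)[d /eqP] : ideal_adj [set 0]%classic zs f.
  apply: ideal_gen_min fzs; first exact: ideal_gen_ideal.
  by move=> g gzs; apply: ideal_gen_sub; right.
by rewrite subr_eq0 => /eqP fE; exists d.
Qed.

(* M = A B, where A writes the generators zs in terms of the regular sequence  *)
(* and B writes the regular sequence in terms of zs.                           *)
Lemma complete_intersection_relations ys zs :
  regular_seq [set 0]%classic ys ->
  ideal_gen [set` ys]%classic = ideal_gen [set` zs]%classic ->
  exists M : 'M[R]_(size zs),
    (forall k : 'I_(size zs), zs`_k = \sum_(l < size zs) M k l * zs`_l) /\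
    (forall c : 'rV_(size zs), \sum_(k < size zs) c 0 k * zs`_k = 0 ->
       forall k : 'I_(size zs), ideal_gen [set` zs]%classic (\det M * c 0 k)).
Proof.
move=> yreg yz.
have /fin_all_exists[A AE] (k : 'I_(size zs)) :
    exists d : nat -> R, zs`_k = \sum_(j < size ys) d j * ys`_j.
  by apply: ideal_gen_seqP; rewrite yz; apply/ideal_gen_sub/mem_nth.
have /fin_all_exists[B BE] (j : 'I_(size ys)) :
    exists d : nat -> R, ys`_j = \sum_(l < size zs) d l * zs`_l.
  by apply: ideal_gen_seqP; rewrite -yz; apply/ideal_gen_sub/mem_nth.
pose mA := \matrix_(k < size zs, j < size ys) A k j.
pose mB := \matrix_(j < size ys, l < size zs) B j l.
have iZ := ideal_gen_ideal [set` zs]%classic; have [_ ZD ZM] := iZ.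
exists (mA *m mB); split=> [k|c c0 k].
  rewrite AE; under eq_bigr do rewrite BE mulr_sumr.
  rewrite exchange_big; apply: eq_bigr => l _ /=; rewrite mxE mulr_suml.
  by apply: eq_bigr => j _; rewrite !mxE mulrA.
(* A syzygy c of [zs] becomes a syzygy c A of the regular sequence, whose coefficients lie in the
   ideal. *)
have cA j : ideal_gen [set` zs]%classic ((c *m mA) 0 j).
  pose cA' (j : nat) := \sum_(k < size zs) c 0 k * A k j.
  have -> : (c *m mA) 0 j = cA' j.
    by rewrite mxE; apply: eq_bigr => l _; rewrite mxE.
  rewrite -yz; apply: (@ideal_gen_min _ ([set 0] `|` [set` ys])%classic).
  - exact: ideal_gen_ideal.
  - move=> f [->|fy]; last exact: ideal_gen_sub.
    by have [] := ideal_gen_ideal [set` ys]%classic.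
  apply: (regular_seq_syzygy ideal_set0 yreg) => //=.
  rewrite -[RHS]c0; under eq_bigr do rewrite mulr_suml.
  rewrite exchange_big; apply: eq_bigr => l _ /=.
  by rewrite AE mulr_sumr; apply: eq_bigr => i _; rewrite mulrA.
(* Cramer's rule for A B exhibits det M times c as a combination of the entries of c A. *)
have -> : \det (mA *m mB) * c 0 k = (c *m mA *m (mB *m \adj (mA *m mB))) 0 k.
  by rewrite -!mulmxA (mulmxA mA) mul_mx_adj mul_mx_scalar mxE.
by rewrite mxE; apply: ideal_sum => // j _; apply: ideal_mulr.
Qed.

End ConormalModule.

Section LocalizationMap.
Variables (R : idomainType) (p : prime_idealr R).
Local Notation "x %:F" := (FracField.tofrac x).

Lemma loc_inj_subproof (f : R) : f%:F \in loc_pred p.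
Proof. by apply/asboolP; exists f, 1; rewrite tofrac1 divr1 idealr1. Qed.

Definition loc_inj (f : R) : loc p := Loc (loc_inj_subproof f).

Lemma loc_inj_is_zmod_morphism : zmod_morphism loc_inj.
Proof. by move=> f g; apply: val_inj; rewrite /= tofracB. Qed.

Lemma loc_inj_is_monoid_morphism : monoid_morphism loc_inj.
Proof.
by split=> [|f g]; apply: val_inj; rewrite /= ?tofrac1 ?tofracM.
Qed.

HB.instance Definition _ := GRing.isZmodMorphism.Build R (loc p) loc_inj
  loc_inj_is_zmod_morphism.
HB.instance Definition _ := GRing.isMonoidMorphism.Build R (loc p) loc_inj
  loc_inj_is_monoid_morphism.

Lemma loc_inj_inj : injective loc_inj.
Proof. by move=> f g /(congr1 val) /eqP /=; rewrite tofrac_eq => /eqP. Qed.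

Lemma notin_primeM s t : s \notin p -> t \notin p -> s * t \notin p.
Proof. by move=> ps pt; rewrite prime_idealrM negb_or ps pt. Qed.

Lemma loc_injV s : s \notin p -> exists t, t * loc_inj s = 1.
Proof.
move=> sp; have tP : (s%:F)^-1 \in loc_pred p.
  by apply/asboolP; exists 1, s; rewrite tofrac1 div1r.
by exists (Loc tP); apply: val_inj; rewrite /= mulVf ?(loc_den_neq0 sp).
Qed.

Lemma loc_den (x : loc p) : exists a s, s \notin p /\ loc_inj s * x = loc_inj a.
Proof.
case: x => x xP; have /asboolP[a [s [sp xE]]] := xP.
exists a, s; split=> //; apply: val_inj => /=.
by rewrite xE mulrC divfK ?(loc_den_neq0 sp).
Qed.

Lemma loc_common_den (I : finType) (X : I -> loc p) :
  exists2 s, s \notin p & exists a : I -> R, forall i, loc_inj s * X i = loc_inj (a i).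
Proof.
have [a /fin_all_exists[s sP]] := fin_all_exists (fun i => loc_den (X i)).
exists (\prod_i s i).
  by apply: (big_ind (fun x => x \notin p)) => [||i _];
    [rewrite idealr1 | exact: notin_primeM | have [] := sP i].
exists (fun i => (\prod_(j | j != i) s j) * a i) => i.
have [_ sa] := sP i.
by rewrite (bigD1 i) //= rmorphM mulrAC sa -rmorphM mulrC.
Qed.

Lemma loc_ideal_inj (J : set R) f : ideal_set J -> loc_ideal p J (loc_inj f) ->
  exists2 s, s \notin p & J (s * f).
Proof.
move=> [_ _ JM] [a [s [Ja sp /= fE]]]; exists s => //.
suff -> : s * f = a by [].
by apply/eqP; rewrite -tofrac_eq tofracM fE mulrC divfK ?(loc_den_neq0 sp).
Qed.

Lemma loc_idealI (J : set R) a s x : J a -> s \notin p ->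
  loc_inj s * x = loc_inj a -> loc_ideal p J x.
Proof.
move=> Ja sp /(congr1 val) /= E; exists a, s; split=> //.
by rewrite -E [X in X / _]mulrC mulfK ?(loc_den_neq0 sp).
Qed.

Lemma loc_idealP (J : set R) x : loc_ideal p J x ->
  exists a s, [/\ J a, s \notin p & loc_inj s * x = loc_inj a].
Proof.
move=> [a [s [Ja sp xE]]]; exists a, s; split=> //.
by apply: val_inj; rewrite /= xE mulrC divfK ?(loc_den_neq0 sp).
Qed.

End LocalizationMap.

(** * The point of Proj belonging to a vertex *)

Section VertexPrime.
Variables (n : nat) (K : fieldType) (v : 'I_n).
Implicit Types (f g : {mpoly K[n]}).

(* The homogeneous prime ideal generated by the variables other than x_v *)
Definition vertex_prime : {pred {mpoly K[n]}} := fun f => mrestr [set v] f == 0.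

Lemma in_vertex_prime f : (f \in vertex_prime) = (mrestr [set v] f == 0).
Proof. by []. Qed.

Lemma vertex_prime_idealr : idealr_closed vertex_prime.
Proof.
split; rewrite ?in_vertex_prime ?rmorph0 ?rmorph1 ?oner_eq0 //.
move=> a f g; rewrite !in_vertex_prime rmorphD rmorphM /= => /eqP -> /eqP ->.
by rewrite mulr0 addr0.
Qed.

HB.instance Definition _ := isIdealr.Build _ vertex_prime vertex_prime_idealr.

Lemma vertex_prime_prime : prime_idealr_closed vertex_prime.
Proof. by move=> f g; rewrite !in_vertex_prime rmorphM mulf_eq0. Qed.

HB.instance Definition _ := isPrimeIdealrClosed.Build _ vertex_prime
  vertex_prime_prime.

Lemma notin_vertex_prime f : f \notin vertex_prime ->
  exists m, mnm_supp m \subset [set v] /\ f@_m != 0.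
Proof.
rewrite in_vertex_prime -msupp_eq0; case E: (msupp _) => [//|m s] _.
exists m; have := mem_head m s; rewrite -E mcoeff_msupp mcoeff_mrestr.
by case: ifP; rewrite ?eqxx.
Qed.

Variable Delta : {set {set 'I_n}}.
Hypothesis DeltaP : simplicial_complex Delta.
Hypothesis vertD : forall i : 'I_n, [set i]%SET \in Delta.

Lemma vertex_prime_in_Proj : in_Proj (sr_ideal K Delta) vertex_prime.
Proof.
split.
- apply/seteqP; split=> f /=; last first.
    pose J := [set f | f \in vertex_prime]%classic.
    apply: (@ideal_gen_min _ _ J) => [|g []//]; split; first exact: rpred0.
      by move=> g h; rewrite /J /=; apply: rpredD.
    move=> a g; rewrite /J /= !in_vertex_prime rmorphM /= => /eqP ->.
    by rewrite mulr0.
  rewrite in_vertex_prime => /eqP f0; rewrite [f]mpolyE big_seq.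
  apply: ideal_sum => [|m mf]; first exact: ideal_gen_ideal.
  apply: ideal_gen_sub; split; last first.
    by apply/homogP; exists (mdeg m); apply: dhomogZ; rewrite dhomogX.
  rewrite /= in_vertex_prime; apply/eqP/mpolyP => k.
  rewrite mcoeff_mrestr mcoeff0 mcoeffZ mcoeffX; case: ifP => // ks.
  case: (m =P k) => [mk|]; rewrite ?mulr0 // mk.
  by have := congr1 (mcoeff k) f0; rewrite mcoeff_mrestr ks mcoeff0 => ->; rewrite mul0r.
- move=> f /(sr_idealP DeltaP) nf; apply/eqP/mpolyP=> m.
  rewrite mcoeff_mrestr mcoeff0; case: ifP => // mv.
  by apply/eqP; apply: contraT => /nf; rewrite (DeltaP (vertD v)).
move=> /(_ 'X_v); rewrite /= in_vertex_prime /mrestr mmapX mmap1U inE eqxx.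
have Xv : max_homog_ideal n K 'X_v by apply: ideal_gen_sub; exists v.
by move/(_ Xv); rewrite -msupp_eq0 msuppX.
Qed.

End VertexPrime.

Arguments vertex_prime [n] K v.

(** * Disjointness of the link circuits *)

Section LocallyCompleteIntersection.
Variables (n : nat) (K : fieldType) (Delta : {set {set 'I_n}}).
Hypothesis DeltaP : simplicial_complex Delta.
Hypothesis lciD : locally_complete_intersection K Delta.
Implicit Types (C D E F : {set 'I_n}) (f g : {mpoly K[n]}) (m t : 'X_{1..n}).
Local Notation I := (sr_ideal K Delta).

Section Vertex.
Variable v : 'I_n.
Local Notation p := (vertex_prime K v : prime_idealr {mpoly K[n]}).
Local Notation iota := (loc_inj p).

Definition link_circuits : seq {set 'I_n} :=
  enum [set E | link_circuit Delta v E].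

Definition link_gens : seq (loc p) :=
  [seq iota 'X_[mnm_ind E] | E <- link_circuits].

Lemma mem_link_circuits E : (E \in link_circuits) = link_circuit Delta v E.
Proof. by rewrite mem_enum inE. Qed.

Lemma link_circuit_notin E : link_circuit Delta v E -> v \notin E.
Proof.
move=> /minsetP[EN Emin]; apply/negP => vE.
have vEE : v |: E = E by apply/setUidPr; rewrite sub1set.
rewrite vEE in EN.
have := Emin (E :\ v); rewrite setD1K // => /(_ EN (subD1set _ _)) /setP/(_ v).
by rewrite !inE eqxx vE.
Qed.

(** For a link circuit E, x_v x_E is in I and x_v is a unit. Conversely, a nonface stays a nonface
    when v is added, so it contains a link circuit. *)
Lemma loc_sr_ideal_gens : ideal_set (loc_ideal p I) ->
  loc_ideal p I = ideal_gen [set` link_gens]%classic.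
Proof.
move=> iL; have iG := ideal_gen_ideal [set` link_gens]%classic.
have [G0 GD GM] := iG.
apply/seteqP; split=> x; last first.
  move: x; apply: ideal_gen_min => // x /mapP[E]; rewrite mem_link_circuits => Ec ->.
  apply: (@loc_idealI _ _ _ 'X_[U_(v) + mnm_ind E] 'X_v); last first.
  - by rewrite -rmorphM mpolyXD.
  - rewrite in_vertex_prime /mrestr mmapX mmap1U inE eqxx.
    by rewrite -msupp_eq0 msuppX.
  apply/(sr_idealX K DeltaP); rewrite mnm_suppD mnm_supp_ind.
  have -> : mnm_supp U_(v) = [set v].
    apply/setP=> i; rewrite in_mnm_supp mnm1E inE (eq_sym i).
    by case: (v == i).
  by have /minsetP[] := Ec.
move=> /loc_idealP[a [s [Ia sp E]]]; have [t ts] := loc_injV sp.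
rewrite -[x]mul1r -ts -mulrA E; apply: (GM) => {x s sp t ts E}.
move: a Ia; pose J := [set a | ideal_gen [set` link_gens] (iota a)]%classic.
apply: (@ideal_gen_min _ _ J).
  split; rewrite /J /= ?rmorph0 //.
    by move=> f g; rewrite /= rmorphD; apply: GD.
  by move=> a f; rewrite /= rmorphM; apply: (GM).
move=> _ [F FN ->]; rewrite /J /= prodX_ind.
have vFN : v |: F \notin Delta.
  by apply: contra FN => /DeltaP; apply; apply: subsetUr.
have [E Ec EF] := minset_exists (P := fun F : {set 'I_n} => v |: F \notin Delta) vFN.
have le : (mnm_ind E <= mnm_ind F)%MM by rewrite mnm_ind_le mnm_supp_ind.
rewrite -(submK le) mpolyXD rmorphM; apply: (GM); apply: ideal_gen_sub.
by apply/mapP; exists E; rewrite ?mem_link_circuits.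
Qed.

(* Evaluating at x_j := 0 for j <> v, a matrix of relations expressing the     *)
(* minimal generators in terms of themselves becomes scalar.                   *)
Lemma link_relation_coef (N : nat) (X : 'I_N -> {set 'I_n}) (s : {mpoly K[n]})
    (A : 'M[{mpoly K[n]}]_N) : injective X ->
  (forall k, link_circuit Delta v (X k)) ->
  (forall k, s * 'X_[mnm_ind (X k)] = \sum_l A k l * 'X_[mnm_ind (X l)]) ->
  map_mx (mrestr [set v]) A = (mrestr [set v] s)%:M.
Proof.
move=> Xinj Xc sA; apply/matrixP => k l; rewrite !mxE; apply/mpolyP => t.
rewrite mcoeffMn !mcoeff_mrestr; case: ifP => [tv|_]; last by rewrite mul0rn.
(* As t is a power of x_v and link circuits avoid v, x_{X i} can divide x_{X l} t only if X i is
   contained in X l, so i = l by minimality. *)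
have coefE (q : {mpoly K[n]}) i : i != l ->
    (q * 'X_[mnm_ind (X i)])@_(mnm_ind (X l) + t) = 0.
  move=> il; apply/eqP; apply: contraNT il => /mcoeffM_neq0[m1 [m2 [mE _]]].
  rewrite mcoeffX; case: (_ =P m2) => [m2E _|_]; last by rewrite eqxx.
  have XiXl : X i \subset X l.
    apply/fintype.subsetP => j ji; have jv : j != v.
      by apply: contraNneq (link_circuit_notin (Xc i)) => <-.
    have : j \in mnm_supp (mnm_ind (X l) + t).
      by rewrite mE -m2E mnm_suppD inE mnm_supp_ind ji orbT.
    rewrite mnm_suppD inE mnm_supp_ind => /orP[//|/(fintype.subsetP tv)].
    by rewrite inE (negbTE jv).
  have /minsetP[iN _] := Xc i; have /minsetP[_ lmin] := Xc l.
  by apply/eqP/Xinj/lmin.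
have := congr1 (mcoeff (mnm_ind (X l) + t)) (sA k).
rewrite raddf_sum (bigD1 l) //= big1 => [|i il]; last exact: coefE.
rewrite /= mcoeffMX addr0 => <-; have [->|kl] := eqVneq k l.
  by rewrite mcoeffMX mulr1n.
by rewrite coefE // mulr0n.
Qed.

Lemma link_circuits_disjoint_at C D x : link_circuit Delta v C ->
  link_circuit Delta v D -> x \in C -> x \in D -> C = D.
Proof.
move=> Cc Dc xC xD; apply/eqP; apply: contraT => CD.
have [ys yreg yL] := lciD.2 p (vertex_prime_in_Proj K v DeltaP lciD.1).
have iL : ideal_set (loc_ideal p I) by rewrite yL; apply: ideal_gen_ideal.
have LE := loc_sr_ideal_gens iL.
have [M [MX MI]] := complete_intersection_relations yreg (etrans (esym yL) LE).
have szE : size link_gens = size link_circuits by rewrite size_map.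
pose X (k : 'I_(size link_gens)) := nth finset.set0 link_circuits k.
have Xlt (k : 'I_(size link_gens)) : (k < size link_circuits)%N.
  by rewrite -szE.
have XE (k : 'I_(size link_gens)) : link_gens`_k = iota 'X_[mnm_ind (X k)].
  by rewrite (nth_map finset.set0).
have Xc k : link_circuit Delta v (X k).
  by rewrite -mem_link_circuits mem_nth.
have Xinj : injective X.
  move=> k l /eqP; rewrite nth_uniq ?enum_uniq // => /eqP kl; exact: val_inj.
have Xsurj E : link_circuit Delta v E -> exists k, X k = E.
  rewrite -mem_link_circuits -index_mem -szE => Elt.
  by exists (Ordinal Elt); rewrite /X /= nth_index // -index_mem -szE.
have [s sp [a aE]] := loc_common_den (fun kl => M kl.1 kl.2).
pose A := \matrix_(k, l) a (k, l).
have AM : map_mx iota A = iota s *: M.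
  by apply/matrixP => k l; rewrite !mxE -(aE (k, l)).
have Arel k : s * 'X_[mnm_ind (X k)] = \sum_l A k l * 'X_[mnm_ind (X l)].
  apply: (@loc_inj_inj _ p); rewrite rmorphM /= -XE MX mulr_sumr rmorph_sum /=.
  by apply: eq_bigr => l _; rewrite mulrA (aE (k, l)) mxE XE -rmorphM /=.
(* A is M with denominators cleared by s; modulo p it is the scalar matrix s, whose determinant is
   nonzero there. *)
have detA : \det A \notin p.
  rewrite in_vertex_prime -det_map_mx (link_relation_coef Xinj Xc Arel).
  by rewrite det_scalar expf_neq0.
have [k kC] := Xsurj C Cc; have [l lD] := Xsurj D Dc.
have kl : k != l by apply: contraNneq CD => kl; rewrite -kC kl lD.
(* The syzygy x_{D \ C} x_C = x_{C \ D} x_D. *)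
pose c := iota 'X_[mnm_ind (D :\: C)] *: delta_mx 0 k
  - iota 'X_[mnm_ind (C :\: D)] *: delta_mx 0 l : 'rV_(size link_gens).
have addE : (mnm_ind (D :\: C) + mnm_ind C = mnm_ind (C :\: D) + mnm_ind D)%MM.
  apply/mnmP=> i; rewrite !mnmDE !mnm_indE !inE.
  by case: (i \in C); case: (i \in D).
have : \sum_(k < size link_gens) c 0 k * link_gens`_k = 0.
  rewrite (bigD1 k) //= (bigD1 l) 1?eq_sym //= big1 => [|i /andP[ik il]].
    rewrite !mxE !eqxx (negbTE kl) eq_sym (negbTE kl) !mulr0 !mulr1 subr0 sub0r.
    by rewrite addr0 mulNr !XE kC lD -!rmorphM -!mpolyXD addE subrr.
  by rewrite !mxE (negbTE ik) (negbTE il) !mulr0 subrr mul0r.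
move=> /MI/(_ k); rewrite -LE => detI.
have ck : c 0 k = iota 'X_[mnm_ind (D :\: C)].
  by rewrite !mxE !eqxx (negbTE kl) mulr1 mulr0 subr0.
have [s' s'p] : exists2 s', s' \notin p & I (s' * (\det A * 'X_[mnm_ind (D :\: C)])).
  apply: loc_ideal_inj; first exact: sr_ideal_ideal.
  rewrite rmorphM /= -det_map_mx AM detZ -ck -mulrA.
  by case: iL => _ _; apply.
(* A polynomial outside p contains a power t of x_v, so t x_{D \ C} has nonface support. Minimality
   of D then forces D \ C = D, against x. *)
rewrite mulrA; have /notin_vertex_prime[t [tv qt]] := notin_primeM s'p detA.
move=> /(sr_idealP DeltaP)/(_ (mnm_ind (D :\: C) + t)%MM).
rewrite mcoeffMX => /(_ qt); rewrite mnm_suppD mnm_supp_ind => tN.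
have /minsetP[_ Dmin] := Dc.
have : D :\: C = D.
  apply: Dmin; last exact: subsetDl.
  apply: contra tN => /DeltaP; apply; rewrite setUC; exact: setSU.
by move/setP/(_ x); rewrite !inE xC xD.
Qed.

End Vertex.

Lemma lci_link_circuits_disjoint : link_circuits_disjoint Delta.
Proof. by move=> v C D x; apply: link_circuits_disjoint_at. Qed.

End LocallyCompleteIntersection.

(** * Lower bounds for the Stanley depth *)

Section CircuitPartition.
Variables (n : nat) (Delta : {set {set 'I_n}}).
Hypothesis DeltaP : simplicial_complex Delta.
Implicit Types (C F G : {set 'I_n}) (i j : 'I_n).

(* Every face F misses some element of each circuit C. The interval of F is   *)
(* determined by the first missing elements: the earlier elements of the      *)
(* circuits are forced to be in, the first missing ones to be out.            *)
Definition prefix_in C F i := [forall (j | (j \in C) && (j <= i)%N), j \in F].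

Definition circuit_lo F : {set 'I_n} :=
  [set i | [exists C, [&& circuit Delta C, i \in C & prefix_in C F i]]].

Definition first_missing C F i :=
  [&& i \in C, ~~ prefix_in C F i &
      [forall (j | (j \in C) && (j < i)%N), prefix_in C F j]].

Definition circuit_hi F : {set 'I_n} :=
  [set i | ~~ [exists C, circuit Delta C && first_missing C F i]].

Lemma prefix_inP C F i :
  reflect (forall j, j \in C -> (j <= i)%N -> j \in F) (prefix_in C F i).
Proof.
apply: (iffP forall_inP) => [FP j jC ji|FP j /andP[jC ji]]; last exact: FP.
by apply: FP; rewrite jC.
Qed.

Lemma first_missing_notin C F i : first_missing C F i -> i \notin F.
Proof.
case/and3P=> iC /negP iN /forall_inP ltP; apply/negP => iF; apply/iN/prefix_inP.
move=> j jC; rewrite leq_eqVlt => /orP[/eqP/val_inj -> //|ji].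
by have := ltP j; rewrite jC ji => /(_ isT)/prefix_inP/(_ j jC); apply.
Qed.

Lemma first_missing_exists C F i : i \in C -> ~~ prefix_in C F i ->
  exists2 j : 'I_n, (j <= i)%N & first_missing C F j.
Proof.
move=> iC iN; have Pi : (i \in C) && ~~ prefix_in C F i by rewrite iC.
pose P (j : 'I_n) := (j \in C) && ~~ prefix_in C F j.
case: (@arg_minnP _ i P (@nat_of_ord n) Pi) => j /andP[jC jN] jmin.
exists j; first exact: jmin.
apply/and3P; split=> //; apply/forall_inP => k /andP[kC kj]; apply: contraT => kN.
by have := jmin k; rewrite /P kC kN leqNgt kj => /(_ isT).
Qed.

Lemma first_missing_inj C F i j : first_missing C F i -> first_missing C F j -> i = j.
Proof.
move=> /and3P[iC iN /forall_inP iP] /and3P[jC jN /forall_inP jP].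
have [ij|ji|/val_inj //] := ltngtP i j.
  by have := jP i; rewrite iC ij (negbTE iN) => /(_ isT).
by have := iP j; rewrite jC ji (negbTE jN) => /(_ isT).
Qed.

Lemma circuit_lo_sub F : circuit_lo F \subset F.
Proof.
apply/fintype.subsetP=> i; rewrite inE => /existsP[C /and3P[_ iC /prefix_inP]].
by apply.
Qed.

Lemma sub_circuit_hi F : F \subset circuit_hi F.
Proof.
apply/fintype.subsetP=> i iF; rewrite inE negb_exists; apply/forallP => C.
by apply/negP => /andP[_ /first_missing_notin]; rewrite iF.
Qed.

(** A circuit inside [circuit_hi F] is not contained in F, and its first element missing from F was
    removed. *)
Lemma circuit_hi_face F : F \in Delta -> circuit_hi F \in Delta.
Proof.
move=> FD; apply: contraT => hN.
have [C Cc Ch] := minset_exists (P := fun F : {set 'I_n} => F \notin Delta) hN.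
have /fintype.subsetPn[i iC iF] : ~~ (C \subset F).
  by have /minsetP[CN _] := Cc; apply: contra CN; apply: DeltaP.
have iN : ~~ prefix_in C F i by apply: contra iF => /prefix_inP; apply.
have [j _ jf] := first_missing_exists iC iN.
have jC : j \in C by case/and3P: jf.
have := fintype.subsetP Ch j jC; rewrite inE => /negP[]; apply/existsP.
by exists C; rewrite jf andbT.
Qed.

(** Each circuit removes at most one element; [pick] sends circuits to these elements, whence the
    detour through options. *)
Lemma card_circuit_hi F : (n - #|[set C | circuit Delta C]| <= #|circuit_hi F|)%N.
Proof.
rewrite leq_subLR -[X in (X <= _)%N](card_ord n) -(cardsC (circuit_hi F)).
rewrite addnC leq_add2r.
pose g C := [pick i | first_missing C F i].
have -> : #|~: circuit_hi F| = #|(@Some _) @: (~: circuit_hi F)|.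
  by rewrite card_imset // => i j [].
apply: leq_trans (leq_imset_card g _); apply: subset_leq_card.
apply/fintype.subsetP => _ /imsetP[i ih ->]; move: ih; rewrite !inE negbK.
case/existsP=> C /andP[Cc Ci]; apply/imsetP; exists C; first by rewrite inE.
rewrite /g; case: pickP => [j Cj|/(_ i)]; last by rewrite Ci.
by rewrite (first_missing_inj Ci Cj).
Qed.

(** Both bounds depend only on which circuit prefixes are contained in the face, and F and G agree
    on these. *)
Lemma circuit_interval F G : circuit_lo G \subset F -> F \subset circuit_hi G ->
  circuit_lo F = circuit_lo G /\ circuit_hi F = circuit_hi G.
Proof.
move=> loF Fhi.
have PE C i : circuit Delta C -> i \in C -> prefix_in C F i = prefix_in C G i.
  move=> Cc iC; apply/idP/idP => [/prefix_inP PF|PG].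
    apply: contraT => NG; have [j ji jf] := first_missing_exists iC NG.
    have jC : j \in C by case/and3P: jf.
    have := fintype.subsetP Fhi j (PF j jC ji); rewrite inE => /negP[].
    by apply/existsP; exists C; rewrite Cc.
  apply/prefix_inP => j jC ji; apply: (fintype.subsetP loF); rewrite inE.
  apply/existsP; exists C; rewrite Cc jC; apply/prefix_inP => k kC kj.
  by move/prefix_inP: PG; apply=> //; apply: leq_trans ji.
split; apply/setP=> i; rewrite !inE; last congr negb.
  apply: eq_existsb => C; have [Cc|//] := boolP (circuit Delta C).
  by have [iC|//] := boolP (i \in C); rewrite PE.
apply: eq_existsb => C; have [Cc|//] := boolP (circuit Delta C).
rewrite /first_missing; have [iC|//] := boolP (i \in C); rewrite PE //.
rewrite /=; congr (_ && _); apply/forall_inP/forall_inP => H j jP.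
  by rewrite -PE ?H //; case/andP: jP.
by rewrite PE ?H //; case/andP: jP.
Qed.

(** F misses an element of every circuit, and disjointness makes these elements distinct. *)
Lemma card_face_circuits F : circuits_disjoint Delta -> F \in Delta ->
  (#|F| <= n - #|[set C | circuit Delta C]|)%N.
Proof.
move=> disj FD.
have gP C : circuit Delta C -> exists2 i, i \in C & i \notin F.
  move=> /minsetP[CN _]; apply/fintype.subsetPn; apply: contra CN; exact: DeltaP.
suff : (#|[set C | circuit Delta C]| <= #|~: F|)%N.
  rewrite -(leq_add2l #|F|) cardsC card_ord => le_n.
  by rewrite leq_subRL ?(leq_trans (leq_addl _ _) le_n) // addnC.
pose g C := [pick i | (i \in C) && (i \notin F)].
have gE C : circuit Delta C -> exists i, [/\ g C = Some i, i \in C & i \notin F].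
  move=> Cc; rewrite /g; case: pickP => [i /andP[iC iF]|N]; first by exists i.
  by have [i iC iF] := gP C Cc; have := N i; rewrite iC iF.
have -> : #|~: F| = #|(@Some _) @: (~: F)| by rewrite card_imset // => i j [].
rewrite -(card_in_imset (f := g)) => [|C D].
  apply: subset_leq_card; apply/fintype.subsetP => x /imsetP[C]; rewrite inE => /gE.
  by move=> [i [-> iC iF]] ->; apply: imset_f; rewrite inE.
rewrite !inE => Cc Dc; have [i [-> iC _]] := gE C Cc.
by have [j [-> jD _]] := gE D Dc => -[ij]; apply: (disj _ _ i); rewrite // ij.
Qed.

End CircuitPartition.

(** * Explicit interval partitions *)

Section SDepthBounds.
Variables (n : nat) (K : fieldType) (Delta : {set {set 'I_n}}).
Hypothesis DeltaP : simplicial_complex Delta.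
Hypothesis vertD : forall i : 'I_n, [set i]%SET \in Delta.
Implicit Types (F G : {set 'I_n}) (i j v w : 'I_n).
Local Notation I := (sr_ideal K Delta).

Lemma sdepth_circuits :
  enat_le (Some (n - #|[set C | circuit Delta C]|)%N) (sdepth I).
Proof.
apply: (sdepth_interval_partition K DeltaP (lo := circuit_lo Delta)
  (hi := circuit_hi Delta)); first exact: leq_subr.
- move=> F FD; split; [exact: circuit_lo_sub | exact: sub_circuit_hi | | ].
    exact: circuit_hi_face.
  exact: card_circuit_hi.
- by move=> F G _ _; apply: circuit_interval.
Qed.

(** The interval from the empty face to {v} absorbs the only small face; each other face forms an
    interval alone. *)
Lemma sdepth_ge1 (v : 'I_n) : enat_le (Some 1%N) (sdepth I).
Proof.
apply: (sdepth_interval_partition K DeltaP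
  (lo := fun F => if F \subset [set v] then finset.set0 else F)
  (hi := fun F => if F \subset [set v] then [set v] else F)).
- by case: (n) v => // -[].
- move=> F FD; case: ifP => Fv; first by rewrite sub0set cards1.
  split=> //; rewrite card_gt0; apply: contraFneq Fv => ->; exact: sub0set.
- move=> F G _ _; case: ifP => Gv; first by move=> _ ->.
  move=> GF FG; have -> : F = G by apply/eqP; rewrite eqEsubset GF FG.
  by rewrite Gv.
Qed.

(** The rank is the distance from r; w is the last but one vertex of a shortest path. *)
Lemma connected_parent (r : 'I_n) : (forall v, connect (adj Delta) r v) ->
  exists rk : 'I_n -> nat, forall v, v != r ->
    exists2 w, adj Delta v w & (rk w < rk v)%N.
Proof.
move=> conn; pose P v k :=
  `[< exists p, [/\ path (adj Delta) r p, v = last r p & size p = k] >].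
have PE v : exists k, P v k.
  have /connectP[p rp vp] := conn v.
  by exists (size p); apply/asboolP; exists p.
exists (fun v => ex_minn (PE v)) => v vr; case: ex_minnP => k /asboolP[p [rp vp <-]] _.
case: (lastP p) rp vp => [_ /= vE|p' x]; first by rewrite vE eqxx in vr.
rewrite rcons_path last_rcons size_rcons => /andP[rp' lx] ->.
exists (last r p'); first by rewrite adj_sym.
case: ex_minnP => m _ /(_ (size p')); apply; apply/asboolP; by exists p'.
Qed.

(* The intervals are [0, {r, s}] for an edge {r, s} at a root r of a spanning  *)
(* tree, [{v}, {v, parent v}] for the other vertices, and the singletons.      *)
Lemma sdepth_connected (r : 'I_n) : (1 < n)%N ->
  (forall v, connect (adj Delta) r v) -> enat_le (Some 2%N) (sdepth I).
Proof.
move=> n2 conn; have [rk rkP] := connected_parent conn.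
have [s rs] : exists s, adj Delta r s.
  have /card_gt1P[x [y [_ _ xy]]] : (1 < #|'I_n|)%N by rewrite card_ord.
  have [v vr] : exists v, v != r.
    have [xr|xr] := eqVneq x r; last by exists x.
    by exists y; rewrite -xr eq_sym.
  have /connectP[[|s p] /= rp vp] := conn v; first by rewrite vp eqxx in vr.
  by exists s; case/andP: rp.
have /fin_all_exists[par parP] (v : 'I_n) :
    exists w, v != r -> adj Delta v w /\ (rk w < rk v)%N.
  have [->|/rkP[w vw rkw]] := eqVneq v r; first by exists r.
  by exists w.
pose e := [set r; s]; pose h v := [set v; par v].
pose sel F v := (v \notin e) && ((F == [set v]) || (F == h v)).
have eD : e \in Delta by case/andP: rs.
have e2 : #|e| = 2 by rewrite cards2; case/andP: rs => ->.
have par_adj v : v \notin e -> adj Delta v (par v) /\ (rk (par v) < rk v)%N.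
  by move=> ve; apply: parP; apply: contraNneq ve => ->; rewrite set21.
have h2 v : v \notin e -> #|h v| = 2.
  by move/par_adj=> [/andP[vp _] _]; rewrite cards2 vp.
have hD v : v \notin e -> h v \in Delta by move/par_adj=> [/andP[]].
(* If two vertices shared their edge, each would be the parent of the other, against the strict
   decrease of the rank. *)
have sel_inj F v w : sel F v -> sel F w -> v = w.
  case/andP=> ve Fv /andP[we Fw].
  case/orP: Fv Fw => /eqP-> /orP[] /eqP E.
  - exact: set1_inj.
  - by have := h2 w we; rewrite -E cards1.
  - by have := h2 v ve; rewrite E cards1.
  apply/eqP; apply: contraT => vw.
  have : v \in h w by rewrite -E set21.
  have : w \in h v by rewrite E set21.
  rewrite !inE eq_sym (negbTE vw) /= => /eqP wE /eqP vE.
  have [_] := par_adj v ve; have [_] := par_adj w we; rewrite -wE -vE.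
  move=> /ltn_trans lt /lt.
  by rewrite ltnn.
have sel_mem F v : sel F v -> v \in F.
  by case/andP=> _ /orP[] /eqP ->; rewrite ?set11 ?set21.
pose lo F := if F \subset e then finset.set0
  else if [pick v | sel F v] is Some v then [set v] else F.
pose hi F := if F \subset e then e
  else if [pick v | sel F v] is Some v then h v else F.
apply: (sdepth_interval_partition K DeltaP (lo := lo) (hi := hi)) => // [F FD|F G _ _].
  rewrite /lo /hi; case: ifP => Fe; first by rewrite sub0set e2.
  case: pickP => [v sv|N].
    have ve : v \notin e by case/andP: sv.
    rewrite sub1set (sel_mem F) // hD // h2 //; split=> //.
    by case/andP: sv => _ /orP[] /eqP ->; rewrite ?sub1set ?set21.
  split=> //; rewrite ltnNge; apply: contraFN Fe => F1.
  have [->|/set0Pn[v vF]] := eqVneq F finset.set0; first exact: sub0set.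
  have FE : F = [set v].
    by apply/esym/eqP; rewrite eqEcard sub1set vF cards1.
  by have := N v; rewrite /sel FE eqxx andbT sub1set => /negbFE.
rewrite /lo /hi; case: (boolP (G \subset e)) => Ge; first by move=> _ ->.
case: pickP => [v sv|N]; last first.
  move=> GF FG; have -> : F = G by apply/eqP; rewrite eqEsubset GF FG.
  by rewrite (negbTE Ge); case: pickP => // v; rewrite N.
rewrite sub1set => vF Fh; have /andP[ve _] := sv.
have sF : sel F v.
  rewrite /sel ve /=; have [pF|pF] := boolP (par v \in F).
    by rewrite orbC eqEsubset Fh subUset !sub1set vF pF.
  rewrite eqEsubset sub1set vF andbT; apply/orP; left.
  apply/fintype.subsetP => w wF; have := fintype.subsetP Fh w wF.
  by rewrite !inE => /orP[//|/eqP wp]; rewrite -wp wF in pF.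
have Fe : ~~ (F \subset e) by apply: contra ve => /fintype.subsetP; apply.
rewrite (negbTE Fe); case: pickP => [w sw|/(_ v)]; last by rewrite sF.
by rewrite (sel_inj F w v sw sF).
Qed.

End SDepthBounds.

Theorem theorem2p11 (K : fieldType) (n : nat) (Delta : {set {set 'I_n}})
    (hDelta : simplicial_complex Delta)
    (hlci : locally_complete_intersection K Delta) :
  enat_le (depth (max_homog_ideal n K) (sr_ideal K Delta))
          (sdepth (sr_ideal K Delta)).
Proof.
have vertD := hlci.1; have link_disj := lci_link_circuits_disjoint hDelta hlci.
have depth_dim e := @depth_le_dim n K Delta hDelta e.
have [n0|n_gt0] := posnP n.
  apply: (@enat_le_trans _ (Some 0%N)); last by case: (sdepth _).
  by apply: depth_dim => F _; apply: leq_trans (max_card _) _; rewrite card_ord n0.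
pose r := Ordinal n_gt0.
have ge1 := sdepth_ge1 K hDelta vertD r.
have [/forallP conn|] := boolP [forall v, connect (adj Delta) r v]; last first.
  rewrite negb_forall => /existsP[v Nrv].
  apply: enat_le_trans ge1.
  pose W := [set w | connect (adj Delta) r w].
  apply: (@depth_disconnected n K Delta hDelta vertD W r v).
  - move=> F FD.
    have [/exists_inP[w wF]|] := boolP [exists w in F, connect (adj Delta) r w].
      move=> rw; apply/orP; left; apply/fintype.subsetP => x xF; rewrite inE.
      have [<- //|wx] := eqVneq w x.
      by apply: connect_trans rw (connect1 _); apply: (face_adj hDelta FD).
    rewrite negb_exists_in => /forall_inP NF; apply/orP; right.
    by apply/fintype.subsetP => x /NF; rewrite !inE.
  - by rewrite inE connect0.
  - by rewrite inE.
have connC v w : connect (adj Delta) v w.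
  apply: connect_trans (conn w); rewrite (sym_connect_sym _) //.
  by move=> a b; rewrite adj_sym.
have [/existsP[v Qv]|] := boolP [exists v, triangle_free Delta v].
  have F2 := connected_triangle_free hDelta link_disj (connC v) Qv.
  (* A single vertex has no edge to start the spanning tree; there the bounds by 1 suffice. *)
  have [n1|n2] := leqP n 1.
    apply: enat_le_trans ge1; apply: depth_dim => F _.
    by apply: leq_trans (max_card _) _; rewrite card_ord.
  apply: enat_le_trans (sdepth_connected K hDelta n2 conn); exact: depth_dim.
rewrite negb_exists => /forallP triangles.
have disj := circuits_disjointP hDelta vertD link_disj connC triangles.
apply: enat_le_trans (sdepth_circuits K hDelta); apply: depth_dim => F.
exact: card_face_circuits.
Qed.
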